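(* Let $q\ge2$, $d=2^q$, let $p,m\in\mathbb{N}_0$ with $m\ge p+1$, and let $\mathbf{x},\mathbf{x}'\in\mathbb{R}^d$ be given in generalized Hopf coordinates, with $r,r',R,R'>0$ and $r\neq r'$. Then, with $m_1=m$, $n_1=n$, $M=\sum_{j=1}^{d/2}m_j$, $N=\sum_{k=1}^{d/2-1}n_k$, $$\begin{aligned} Q_{m-\frac12}^{p+\frac12}(\chi)&=(-1)^{\frac d2-1}2^{\frac d2-1}\frac{(p+m)!}{(m-p-1)!}(\chi^2-1)^{-\frac p2-\frac14}\left(\frac{rr'}{RR'}\right)^p\left(\frac{r_>^2-r_<^2}{2rr'}\right)^{p+\frac{d-1}2}\\ &\times\sum_{m_2=0}^\infty\epsilon_{m_2}\cos(m_2(\phi_2-\phi_2'))\cdots\sum_{m_{d/2}=0}^\infty\epsilon_{m_{d/2}}\cos(m_{d/2}(\phi_{d/2}-\phi_{d/2}'))\\ &\times\sum_{n_{d/2-1}=0}^\infty\Psi_{d/2-1}\cdots\sum_{n=0}^\infty\Psi_1\,\frac{(2N+M-p-1)!}{(p+2N+M+d-2)!}\,Q_{2N+M+\frac{d-3}2}^{p+\frac{d-1}2}(\zeta). \end{aligned}$$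
   Context: $\mathbb{N}_0=\{0,1,2,\ldots\}$; $\epsilon_m=2-\delta_{m,0}$; $r_>=\max\{r,r'\}$, $r_<=\min\{r,r'\}$. Generalized Hopf coordinates on $\mathbb{R}^d$, $d=2^q$: radius $r\ge0$, angles $\vartheta_k\in[0,\frac\pi2]$ ($1\le k\le\frac d2-1$), $\phi_j\in[-\pi,\pi)$ ($1\le j\le\frac d2$). Define $\rho_1=r$, $\rho_{2k}=\rho_k\cos\vartheta_k$, $\rho_{2k+1}=\rho_k\sin\vartheta_k$ for $1\le k\le\frac d2-1$; then for $\frac d2\le j\le d-1$, $x_{2j-d+1}=\rho_j\cos\phi_{d-j}$ and $x_{2j-d+2}=\rho_j\sin\phi_{d-j}$. Put $R=\rho_{d-1}$, so $x_{d-1}=R\cos\phi_1$, $x_d=R\sin\phi_1$. Primed quantities refer to $\mathbf{x}'$. Put $$\zeta=\frac{r^2+r'^2}{2rr'},\qquad\chi=\frac{R^2+R'^2+\sum_{j=1}^{d-2}(x_j-x_j')^2}{2RR'}.$$ Quantum numbers: given $m_1,\ldots,m_{d/2}\in\mathbb{N}_0$ and $n_1,\ldots,n_{d/2-1}\in\mathbb{N}_0$, set $l_j=m_{d-j}$ for $\frac d2\le j\le d-1$ and recursively $l_k=2n_k+l_{2k}+l_{2k+1}$ for $k=\frac d2-1,\ldots,1$ (so $l_1=2N+M$). For $1\le k\le\frac d2-1$ put $\alpha_k=l_{2k}-1+2^{\log_2(d/4)-\lfloor\log_2k\rfloor}$, $\beta_k=l_{2k+1}-1+2^{\log_2(d/4)-\lfloor\log_2k\rfloor}$,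 $$\Upsilon_k(\vartheta)=\sqrt{\frac{(2n_k+\alpha_k+\beta_k+1)(n_k+\alpha_k+\beta_k)!\,n_k!}{(n_k+\alpha_k)!(n_k+\beta_k)!}}\,(\cos\vartheta)^{l_{2k}}(\sin\vartheta)^{l_{2k+1}}P_{n_k}^{(\beta_k,\alpha_k)}(\cos2\vartheta),$$ and $\Psi_k=\Upsilon_k(\vartheta_k)\Upsilon_k(\vartheta_k')$, where $P_n^{(\alpha,\beta)}$ is the Jacobi polynomial. In the multi-sum the whole expression to the right of each summation sign is summed. For $z>1$ the associated Legendre function of the second kind is $$Q_\nu^\mu(z)=\frac{\sqrt{\pi}\,e^{i\pi\mu}\,\Gamma(\nu+\mu+1)(z^2-1)^{\mu/2}}{2^{\nu+1}\Gamma(\nu+\frac32)z^{\nu+\mu+1}}\,{}_2F_1\!\left(\tfrac{\nu+\mu+1}{2},\tfrac{\nu+\mu+2}{2};\nu+\tfrac32;\tfrac1{z^2}\right).$$ *)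

(* Defs.v *)
From Stdlib Require Import Reals Lra Lia List Arith PArith.
From Coquelicot Require Import Coquelicot.
Open Scope R_scope.

(** * Special functions *)

Fixpoint poch (a : R) (n : nat) : R :=
  match n with
  | O => 1
  | S n' => poch a n' * (a + INR n')
  end.

(* Euler's limit; valid at every real x that is not a non-positive integer. *)
Definition Gamma (x : R) : R :=
  real (Lim_seq (fun n => INR (fact n) * Rpower (INR n) x / poch x (S n))).

Definition hyp2F1 (a b c z : R) : R :=
  Series (fun n => poch a n * poch b n / (poch c n * INR (fact n)) * z ^ n).

(* The series terminates, since poch (- INR n) k = 0 for k > n. *)
Definition jacobi (n : nat) (a b x : R) : R :=
  poch (a + 1) n / INR (fact n)
  * hyp2F1 (- INR n) (INR n + a + b + 1) (a + 1) ((1 - x) / 2).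

Definition cis (t : R) : C := (cos t, sin t).

(* Meant for z > 1. *)
Definition legendreQ (nu mu z : R) : C :=
  (cis (PI * mu) *
   RtoC (sqrt PI * Gamma (nu + mu + 1) * Rpower (z ^ 2 - 1) (mu / 2)
         / (Rpower 2 (nu + 1) * Gamma (nu + 3 / 2) * Rpower z (nu + mu + 1))
         * hyp2F1 ((nu + mu + 1) / 2) ((nu + mu + 2) / 2) (nu + 3 / 2)
                  (1 / z ^ 2)))%C.

(** * Generalized Hopf coordinates *)

(* Indices start at 1; only [angle k] for 1 <= k <= d/2 - 1 and [phase j]
   for 1 <= j <= d/2 are meaningful. *)
Record hopf := Hopf {
  radius : R;
  angle : nat -> R;
  phase : nat -> R
}.

Definition is_hopf (d : nat) (x : hopf) : Prop :=
  0 <= radius x /\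
  (forall k, (1 <= k <= d / 2 - 1)%nat -> 0 <= angle x k <= PI / 2) /\
  (forall j, (1 <= j <= d / 2)%nat -> - PI <= phase x j < PI).

(* The children of node k in the binary tree are 2k = k~0 and 2k+1 = k~1. *)
Fixpoint rho_pos (x : hopf) (k : positive) : R :=
  match k with
  | xH => radius x
  | xO k' => rho_pos x k' * cos (angle x (Pos.to_nat k'))
  | xI k' => rho_pos x k' * sin (angle x (Pos.to_nat k'))
  end.

Definition rho (x : hopf) (k : nat) : R := rho_pos x (Pos.of_nat k).

Lemma rho_1 x : rho x 1 = radius x.
Proof. reflexivity. Qed.

Lemma rho_even x k : (1 <= k)%nat ->
  rho x (2 * k) = rho x k * cos (angle x k).
Proof.
  intros Hk. unfold rho.
  replace (Pos.of_nat (2 * k)) with (Pos.of_nat k)~0%positive by lia.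
  simpl. rewrite Nat2Pos.id by lia. reflexivity.
Qed.

Lemma rho_odd x k : (1 <= k)%nat ->
  rho x (2 * k + 1) = rho x k * sin (angle x k).
Proof.
  intros Hk. unfold rho.
  replace (Pos.of_nat (2 * k + 1)) with (Pos.of_nat k)~1%positive by lia.
  simpl. rewrite Nat2Pos.id by lia. reflexivity.
Qed.

(* Cartesian coordinate number i, for 1 <= i <= d; see [cart_cos] and
   [cart_sin]. *)
Definition cart (d : nat) (x : hopf) (i : nat) : R :=
  let j := ((d + i - 1) / 2)%nat in
  rho x j * (if Nat.odd i then cos (phase x (d - j)) else sin (phase x (d - j))).

Lemma cart_cos d x j : Nat.Even d -> (d / 2 <= j <= d - 1)%nat ->
  cart d x (2 * j + 1 - d) = rho x j * cos (phase x (d - j)).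
Proof.
  intros [e ->] Hj. rewrite (Nat.mul_comm 2 e), Nat.div_mul in Hj by lia.
  unfold cart.
  replace (2 * e + (2 * j + 1 - 2 * e) - 1)%nat with (j * 2)%nat by lia.
  rewrite Nat.div_mul by lia.
  replace (2 * j + 1 - 2 * e)%nat with (1 + 2 * (j - e))%nat by lia.
  rewrite Nat.odd_add_mul_2. reflexivity.
Qed.

Lemma cart_sin d x j : Nat.Even d -> (d / 2 <= j <= d - 1)%nat ->
  cart d x (2 * j + 2 - d) = rho x j * sin (phase x (d - j)).
Proof.
  intros [e ->] Hj. rewrite (Nat.mul_comm 2 e), Nat.div_mul in Hj by lia.
  unfold cart.
  replace (2 * e + (2 * j + 2 - 2 * e) - 1)%nat with (1 + j * 2)%nat by lia.
  rewrite Nat.div_add by lia.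
  replace (2 * j + 2 - 2 * e)%nat with (2 + 2 * (j - e))%nat by lia.
  rewrite Nat.odd_add_mul_2. reflexivity.
Qed.

Definition bigR (d : nat) (x : hopf) : R := rho x (d - 1).

Definition zeta (x x' : hopf) : R :=
  (radius x ^ 2 + radius x' ^ 2) / (2 * radius x * radius x').

Definition chi (d : nat) (x x' : hopf) : R :=
  (bigR d x ^ 2 + bigR d x' ^ 2
   + sum_n_m (fun j => (cart d x j - cart d x' j) ^ 2) 1 (d - 2))
  / (2 * bigR d x * bigR d x').

(** * Quantum numbers *)

(* Quantum numbers are 1-based functions: [ms j] is m_j for 1 <= j <= d/2
   and [ns k] is n_k for 1 <= k <= d/2 - 1. *)

Fixpoint ell_fuel (fuel d : nat) (ms ns : nat -> nat) (k : nat) : nat :=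
  match fuel with
  | O => O
  | S f =>
      if (k <? d / 2)%nat
      then (2 * ns k + ell_fuel f d ms ns (2 * k)
            + ell_fuel f d ms ns (2 * k + 1))%nat
      else ms (d - k)%nat
  end.

(* d levels suffice, as doubling leads from any k >= 1 to the leaves
   d/2 <= k <= d - 1 in fewer steps; see [ell_leaf] and [ell_node]. *)
Definition ell (d : nat) (ms ns : nat -> nat) (k : nat) : nat :=
  ell_fuel d d ms ns k.

Lemma ell_leaf d ms ns k : (d / 2 <= k <= d - 1)%nat -> (1 <= k)%nat ->
  ell d ms ns k = ms (d - k)%nat.
Proof.
  intros Hk H1. unfold ell. destruct d as [|d']; [lia|].
  cbn [ell_fuel]. destruct (Nat.ltb_spec k (S d' / 2)); [lia | reflexivity].
Qed.

Lemma ell_fuel_enough d ms ns f : forall g k, (1 <= k)%nat ->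
  (d < k + f)%nat -> (d < k + g)%nat -> (1 <= f)%nat -> (1 <= g)%nat ->
  ell_fuel f d ms ns k = ell_fuel g d ms ns k.
Proof.
  induction f as [|f IH]; intros [|g] k Hk Hf Hg Hf1 Hg1; try lia.
  cbn [ell_fuel]. destruct (Nat.ltb_spec k (d / 2)) as [Hlt|]; [|reflexivity].
  pose proof (Nat.Div0.mul_div_le d 2).
  rewrite (IH g (2 * k)%nat), (IH g (2 * k + 1)%nat) by lia. reflexivity.
Qed.

Lemma ell_node d ms ns k : (1 <= k <= d / 2 - 1)%nat ->
  ell d ms ns k
  = (2 * ns k + ell d ms ns (2 * k) + ell d ms ns (2 * k + 1))%nat.
Proof.
  intros Hk. unfold ell. pose proof (Nat.Div0.mul_div_le d 2).
  rewrite (ell_fuel_enough d ms ns d (S d) k) by lia.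
  cbn [ell_fuel]. destruct (Nat.ltb_spec k (d / 2)); [reflexivity | lia].
Qed.

(* Adding the power of two first keeps the subtraction of 1 exact. *)
Definition alpha (d : nat) (ms ns : nat -> nat) (k : nat) : nat :=
  (ell d ms ns (2 * k) + 2 ^ (Nat.log2 (d / 4) - Nat.log2 k) - 1)%nat.

Definition beta (d : nat) (ms ns : nat -> nat) (k : nat) : nat :=
  (ell d ms ns (2 * k + 1) + 2 ^ (Nat.log2 (d / 4) - Nat.log2 k) - 1)%nat.

Definition Upsilon (d : nat) (ms ns : nat -> nat) (k : nat) (t : R) : R :=
  let n := ns k in
  let a := alpha d ms ns k in
  let b := beta d ms ns k in
  sqrt (INR (2 * n + a + b + 1) * INR (fact (n + a + b)) * INR (fact n)
        / (INR (fact (n + a)) * INR (fact (n + b))))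
  * cos t ^ ell d ms ns (2 * k) * sin t ^ ell d ms ns (2 * k + 1)
  * jacobi n (INR b) (INR a) (cos (2 * t)).

Definition Psi (d : nat) (x x' : hopf) (ms ns : nat -> nat) (k : nat) : R :=
  Upsilon d ms ns k (angle x k) * Upsilon d ms ns k (angle x' k).

Definition sumM (d : nat) (ms : nat -> nat) : nat :=
  list_sum (map ms (seq 1 (d / 2))).

Definition sumN (d : nat) (ns : nat -> nat) : nat :=
  list_sum (map ns (seq 1 (d / 2 - 1))).

Definition neumann (m : nat) : R := 2 - (if (m =? 0)%nat then 1 else 0).

Definition upd (f : nat -> nat) (k v : nat) : nat -> nat :=
  fun i => if (i =? k)%nat then v else f i.

(** * The multi-sum *)

(* sum_{i >= 0} w_i s_i = v, where the s_i are the (unique) values such that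
   [inner i s_i]; in particular every inner sum has to converge. *)
Definition is_weighted_sum (w : nat -> R) (inner : nat -> C -> Prop) (v : C)
  : Prop :=
  exists s : nat -> C,
    (forall i, inner i (s i)) /\ is_series (fun i => RtoC (w i) * s i)%C v.

Definition summand (d p : nat) (x x' : hopf) (ms ns : nat -> nat) : C :=
  let L := (2 * sumN d ns + sumM d ms)%nat in
  (RtoC (INR (fact (L - p - 1)) / INR (fact (p + L + d - 2)))
   * legendreQ (INR L + (INR d - 3) / 2) (INR p + (INR d - 1) / 2)
               (zeta x x'))%C.

(* v = sum_{n_k} Psi_k sum_{n_(k-1)} Psi_(k-1) ... sum_{n_1} Psi_1 summand *)
Fixpoint is_n_sum (d p : nat) (x x' : hopf) (k : nat) (ms ns : nat -> nat)
  (v : C) : Prop :=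
  match k with
  | O => v = summand d p x x' ms ns
  | S k' =>
      is_weighted_sum
        (fun n => Psi d x x' ms (upd ns k n) k)
        (fun n => is_n_sum d p x x' k' ms (upd ns k n)) v
  end.

(* The sums over m_j, ..., m_(d/2), where c = d/2 + 1 - j of them remain,
   followed by the sums over n_(d/2-1), ..., n_1. *)
Fixpoint is_m_sum (d p : nat) (x x' : hopf) (c : nat) (ms ns : nat -> nat)
  (v : C) : Prop :=
  match c with
  | O => is_n_sum d p x x' (d / 2 - 1) ms ns v
  | S c' =>
      let j := (d / 2 + 1 - c)%nat in
      is_weighted_sum
        (fun i => neumann i * cos (INR i * (phase x j - phase x' j)))
        (fun i => is_m_sum d p x x' c' (upd ms j i) ns) v
  end.

(* All quantum numbers other than m_1 = m are summed over, so their initial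
   value 0 is irrelevant. *)
Definition is_multi_sum (d p m : nat) (x x' : hopf) (v : C) : Prop :=
  is_m_sum d p x x' (d / 2 - 1) (upd (fun _ => O) 1 m) (fun _ => O) v.

(* Main.v *)
Require Import Defs.
From Stdlib Require Import Reals Arith Lra Lia List FunctionalExtensionality.
From Coquelicot Require Import Coquelicot.
Open Scope R_scope.

(* Up to elementary factors, both Legendre functions are Laplace transforms of
   modified Bessel functions: the left-hand side is the integral of
   exp(- chi z) I_m(z) z^(-p-1), and each summand is that of
   exp(- zeta z) I_(L+d/2-1)(z) z^(-p-d/2).  Under the transform, the sum over
   [n_k] is Bateman's expansion of a product I_al(z c c') I_be(z s s') in the
   functions I_(al+be+2n+1)(z), so that summing over n_1, n_2, ... replaces
   node k of the binary tree by its two children, until only the leaves remain.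
   The sum over [m_j] is the Fourier expansion of exp(z cos phi) and turns a
   leaf into an exponential, which moves the argument of the transform from
   zeta to chi.

   The transform is taken termwise, on power series: each expansion is then a
   finite identity in every coefficient, and the sums are exchanged because
   all series are dominated by exp(r r' z), where r r' < (r^2 + r'^2) / 2. *)

(** * Finite sums *)

(** A node carries [I_(l+h)(a z) / (a z)^h], where [a] is the product of its two radii [rho] and [h]
    is half the number of coordinates below it, minus one. The division makes the node entire in
    [a], so angles at which a radius vanishes need no separate treatment. It also makes the orders
    fit: children of orders [l + h] and [m + h] produce [(2 n + l + m) + (2 h + 1)], and [2 h + 1]
    is the [h] of the parent. The factor 2 of each such step accounts for [2^(d/2-1)].

    Terms change sign, so no sum may be exchanged without a majorant. A product of nodes is bounded
    by an exponential whose rate is the sum of the [a], and splitting a node multiplies its share by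
    [cos (t - t') <= 1]; hence every frontier keeps a rate of at most [r r'].

    The transform of a Bessel series is a hypergeometric series with parameters
    [(N-P)/2, (N-P+1)/2], whereas [legendreQ] has [(N+P+1)/2, (N+P+2)/2]; Euler's transformation
    reconciles the two. *)

Lemma sum_f_R0_shift (f : nat -> R) n :
  sum_f_R0 f (S n) = f 0%nat + sum_f_R0 (fun i => f (S i)) n.
Proof. rewrite decomp_sum by lia. reflexivity. Qed.

Lemma sum_f_R0_lin (a b : R) (f g : nat -> R) n :
  sum_f_R0 (fun i => a * f i + b * g i) n
  = a * sum_f_R0 f n + b * sum_f_R0 g n.
Proof. induction n as [|n IH]; simpl; [|rewrite IH]; ring. Qed.

Lemma sum_f_R0_scal (a : R) (f : nat -> R) n :
  sum_f_R0 (fun i => a * f i) n = a * sum_f_R0 f n.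
Proof. induction n as [|n IH]; simpl; [|rewrite IH]; ring. Qed.

Lemma sum_f_R0_zero (f : nat -> R) n :
  (forall i, (i <= n)%nat -> f i = 0) -> sum_f_R0 f n = 0.
Proof.
  intros Hf. rewrite (sum_eq f (fun _ => 0)) by exact Hf.
  rewrite sum_cte. ring.
Qed.

Lemma sum_f_R0_trunc (f : nat -> R) m n : (m <= n)%nat ->
  (forall i, (m < i)%nat -> f i = 0) -> sum_f_R0 f n = sum_f_R0 f m.
Proof.
  intros Hmn Hf. induction Hmn as [|n Hmn IH]; [reflexivity|].
  simpl. rewrite IH, Hf by lia. ring.
Qed.

Lemma sum_f_R0_swap (f : nat -> nat -> R) m n :
  sum_f_R0 (fun i => sum_f_R0 (fun j => f i j) n) m
  = sum_f_R0 (fun j => sum_f_R0 (fun i => f i j) m) n.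
Proof.
  induction m as [|m IH]; simpl; [reflexivity|].
  rewrite IH, <- plus_sum. reflexivity.
Qed.

Definition asum (F : nat -> nat -> R) (K : nat) : R :=
  sum_f_R0 (fun i => F i (K - i)%nat) K.

Lemma asum_ext F G K :
  (forall i j, (i + j = K)%nat -> F i j = G i j) -> asum F K = asum G K.
Proof. intros H. apply sum_eq. intros i Hi. apply H. lia. Qed.

Lemma asum_lin a b F G K :
  asum (fun i j => a * F i j + b * G i j) K = a * asum F K + b * asum G K.
Proof. apply sum_f_R0_lin. Qed.

Lemma asum_shift F K :
  asum F (S K) = F 0%nat (S K) + asum (fun i j => F (S i) j) K.
Proof. unfold asum. rewrite sum_f_R0_shift. reflexivity. Qed.

Lemma asum_shift_r F K :
  asum F (S K) = F (S K) 0%nat + asum (fun i j => F i (S j)) K.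
Proof.
  unfold asum. rewrite tech5, Nat.sub_diag, Rplus_comm. f_equal.
  apply sum_eq. intros i Hi. cbv beta. rewrite Nat.sub_succ_l by lia. reflexivity.
Qed.

(** The shape of every degree-lowering step below: a factor that vanishes at index 0 allows that
    index to be shifted, so that an antidiagonal of degree [S K] becomes one of degree [K]. *)
Lemma asum_raise F G K :
  (forall j, F 0%nat j = 0) -> (forall i, G i 0%nat = 0) ->
  asum (fun i j => F i j + G i j) (S K)
  = asum (fun i j => F (S i) j + G i (S j)) K.
Proof.
  intros HF HG.
  transitivity (1 * asum F (S K) + 1 * asum G (S K)).
  { rewrite <- asum_lin. apply asum_ext. intros; ring. }
  rewrite asum_shift, asum_shift_r, HF, HG, !Rplus_0_l.
  rewrite <- asum_lin. apply asum_ext. intros; ring.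
Qed.

(** * Pochhammer symbols and the Chu-Vandermonde sum *)

Lemma INR_fact_pos n : 0 < INR (fact n).
Proof. apply INR_fact_lt_0. Qed.

Lemma fact_S n : INR (fact (S n)) = (INR n + 1) * INR (fact n).
Proof. rewrite fact_simpl, mult_INR, S_INR. reflexivity. Qed.

Lemma poch_pos a n : 0 < a -> 0 < poch a n.
Proof.
  intros Ha. induction n as [|n IH]; simpl; [lra|].
  apply Rmult_lt_0_compat; [exact IH|]. pose proof (pos_INR n). lra.
Qed.

Lemma poch_nat a n : poch (INR a + 1) n = INR (fact (a + n)) / INR (fact a).
Proof.
  pose proof (INR_fact_pos a).
  induction n as [|n IH]; simpl.
  - rewrite Nat.add_0_r. field. lra.
  - rewrite IH, Nat.add_succ_r, fact_S, plus_INR. field. lra.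
Qed.

Lemma poch_opp a n : (n <= a)%nat ->
  poch (- INR a) n = (-1) ^ n * (INR (fact a) / INR (fact (a - n))).
Proof.
  induction n as [|n IH]; intros Hn; simpl.
  - rewrite Nat.sub_0_r. field. apply INR_fact_neq_0.
  - rewrite IH by lia.
    replace (a - n)%nat with (S (a - S n)) by lia. rewrite fact_S.
    rewrite minus_INR, S_INR by lia.
    assert (INR n + 1 <= INR a) by (rewrite <- S_INR; apply le_INR; lia).
    field. split; [apply INR_fact_neq_0 | lra].
Qed.

Lemma poch_opp_zero a n : (a < n)%nat -> poch (- INR a) n = 0.
Proof.
  induction n as [|n IH]; intros Hn; [lia|]. simpl.
  destruct (Nat.eq_dec a n) as [->|]; [ring|]. rewrite IH by lia. ring.
Qed.

(** Multiplying by [S K = i + j] and lowering the index that was multiplied produces the factor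
    [(a + i) + (b + j)], which is constant on the antidiagonal. *)
Lemma chu_vandermonde a b K :
  asum (fun i j => poch a i / INR (fact i) * (poch b j / INR (fact j))) K
  = poch (a + b) K / INR (fact K).
Proof.
  induction K as [|K IH]; [unfold asum; simpl; field|].
  apply (Rmult_eq_reg_l (INR (S K))); [|apply not_0_INR; lia].
  set (F := fun i j => poch a i / INR (fact i) * (poch b j / INR (fact j))).
  transitivity (asum (fun i j => INR i * F i j + INR j * F i j) (S K)).
  { unfold asum. rewrite <- sum_f_R0_scal. apply sum_eq. intros i Hi.
    rewrite minus_INR by lia. unfold F. ring. }
  rewrite asum_raise by (intros; simpl; ring).
  transitivity ((a + b + INR K) * asum F K).
  { unfold asum. rewrite <- sum_f_R0_scal. apply sum_eq. intros i Hi. unfold F.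
    rewrite !fact_S, !S_INR, minus_INR by lia. simpl poch.
    pose proof (pos_INR i). pose proof (le_INR _ _ Hi).
    rewrite !minus_INR by lia.
    field. repeat split; try apply INR_fact_neq_0; lra. }
  fold F in IH. rewrite IH. simpl poch. rewrite fact_S, S_INR.
  field. split; [apply INR_fact_neq_0 | pose proof (pos_INR K); lra].
Qed.

(** * Bateman's expansion, coefficientwise *)

(** The coefficients in the product of the series of [I_al] and [I_be], stripped of arguments and
    powers of 2. *)
Definition bateman_weight (al be i j : nat) : R :=
  / (INR (fact i) * INR (fact (al + i)) * INR (fact j) * INR (fact (be + j))).

(* [bern i j k] is the coefficient of [u^k] in [(1 - u)^i u^j]. *)
Fixpoint bern (i j k : nat) : R :=
  match i with
  | O => if (k =? j)%nat then 1 else 0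
  | S i' => bern i' j k - bern i' (S j) k
  end.

Lemma bern_high i : forall j k, (i + j < k)%nat -> bern i j k = 0.
Proof.
  induction i as [|i IH]; intros j k Hk; simpl.
  - destruct (Nat.eqb_spec k j); [lia|reflexivity].
  - rewrite !IH by lia. ring.
Qed.

Lemma bern_top i : forall j k, k = (i + j)%nat -> bern i j k = (-1) ^ i.
Proof.
  induction i as [|i IH]; intros j k ->; simpl.
  - rewrite Nat.eqb_refl. reflexivity.
  - rewrite bern_high by lia. rewrite (IH (S j)) by lia. ring.
Qed.

Lemma bern_eval u i : forall j K, (i + j <= K)%nat ->
  sum_f_R0 (fun k => bern i j k * u ^ k) K = (1 - u) ^ i * u ^ j.
Proof.
  induction i as [|i IH]; intros j K HK; simpl.
  - rewrite (sum_f_R0_trunc _ j K);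
      [| lia | intros k Hk; destruct (Nat.eqb_spec k j); [lia|ring]].
    destruct j as [|j]; [simpl; ring|]. simpl sum_f_R0.
    rewrite Nat.eqb_refl, sum_f_R0_zero; [simpl; ring|].
    intros k Hk. destruct (Nat.eqb_spec k (S j)); [lia|ring].
  - rewrite (sum_eq _ (fun k => 1 * (bern i j k * u ^ k)
                               + (-1) * (bern i (S j) k * u ^ k)))
      by (intros; ring).
    rewrite sum_f_R0_lin, !IH by lia. simpl. ring.
Qed.

(* [jacobi_op s be K] is the action on coefficient sequences of
   [u (1 - u) D^2 + (be + 1 - (s + 1) u) D + K (K + s)], whose kernel in
   degree [K] is spanned by the Jacobi polynomial. *)
Definition jacobi_op (s be K : R) (e : nat -> R) (k : nat) : R :=
  (INR k + 1) * (INR k + be + 1) * e (S k)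
  + (K - INR k) * (K + INR k + s) * e k.

(** With the degree parameter set to 0 the operator does not depend on [i + j], so the induction can
    follow the recursion of [bern], whose two terms have different degrees. *)
Lemma jacobi_op_bern_aux (al be : R) i : forall j k,
  jacobi_op (al + be + 1) be 0 (bern i j) k
  = INR i * (INR i + al) * bern (pred i) (S j) k
    + INR j * (INR j + be) * bern (S i) (pred j) k
    - (2 * INR i * INR j + (be + 1) * INR i + (al + 1) * INR j) * bern i j k.
Proof.
  unfold jacobi_op.
  induction i as [|i IH]; intros j k.
  - simpl bern. simpl INR.
    destruct j as [|j]; simpl pred.
    + destruct k as [|k]; cbn -[INR]; simpl (INR 0); ring.
    + rewrite (S_INR j).
      destruct (Nat.eqb_spec (S k) (S j)); destruct (Nat.eqb_spec k j);
        destruct (Nat.eqb_spec k (S j)); try lia; subst;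
        rewrite ?S_INR; ring.
  - pose proof (IH j k) as H0. pose proof (IH (S j) k) as H1.
    rewrite S_INR. simpl pred in *.
    change (bern (S i) j (S k)) with (bern i j (S k) - bern i (S j) (S k)).
    change (bern (S i) j k) with (bern i j k - bern i (S j) k).
    rewrite S_INR in H1.
    replace ((INR k + 1) * (INR k + be + 1) * (bern i j (S k) - bern i (S j) (S k)) +
      (0 - INR k) * (0 + INR k + (al + be + 1)) * (bern i j k - bern i (S j) k))
      with (((INR k + 1) * (INR k + be + 1) * bern i j (S k) +
       (0 - INR k) * (0 + INR k + (al + be + 1)) * bern i j k)
       - ((INR k + 1) * (INR k + be + 1) * bern i (S j) (S k) +
       (0 - INR k) * (0 + INR k + (al + be + 1)) * bern i (S j) k)) by ring.
    rewrite H0, H1.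
    destruct i as [|i]; destruct j as [|j]; cbn [bern pred];
      simpl (INR 0); ring.
Qed.

(** The term [K (K + s)] at [K = i + j] cancels the diagonal part of [jacobi_op_bern_aux]; what
    remains has degree one less. *)
Lemma jacobi_op_bern (al be : R) i j k :
  jacobi_op (al + be + 1) be (INR (i + j)) (bern i j) k
  = INR i * (INR i + al) * bern (pred i) j k
    + INR j * (INR j + be) * bern i (pred j) k.
Proof.
  replace (jacobi_op (al + be + 1) be (INR (i + j)) (bern i j) k) with
    (jacobi_op (al + be + 1) be 0 (bern i j) k
     + INR (i + j) * (INR (i + j) + al + be + 1) * bern i j k)
    by (unfold jacobi_op; ring).
  rewrite jacobi_op_bern_aux, plus_INR.
  destruct i as [|i]; destruct j as [|j]; simpl pred; simpl (INR 0).
  - ring.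
  - change (bern 1 j k) with (bern 0 j k - bern 0 (S j) k). ring.
  - change (bern (S i) 0 k) with (bern i 0 k - bern i 1 k). ring.
  - change (bern (S (S i)) j k) with (bern (S i) j k - bern (S i) (S j) k).
    change (bern (S i) (S j) k) with (bern i (S j) k - bern i (S (S j)) k). ring.
Qed.

(** Downward recursion from degree [K]: the factor [(K - k) (K + k + s)] of [e k] is nonzero for
    [k < K]. *)
Lemma jacobi_op_kernel (s be : R) (K : nat) (e : nat -> R) :
  0 < s -> (forall k, (K <= k)%nat -> e k = 0) ->
  (forall k, jacobi_op s be (INR K) e k = 0) -> forall k, e k = 0.
Proof.
  intros Hs Hhigh Hker.
  assert (H : forall t k, (k + t = K)%nat -> e k = 0).
  { induction t as [|t IH]; intros k Hk; [apply Hhigh; lia|].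
    specialize (Hker k). unfold jacobi_op in Hker.
    rewrite (IH (S k)) in Hker by lia.
    assert (HkK : INR k + 1 <= INR K) by (rewrite <- S_INR; apply le_INR; lia).
    pose proof (pos_INR k).
    rewrite Rmult_0_r, Rplus_0_l in Hker.
    apply Rmult_integral in Hker as [Hker|]; [|assumption].
    apply Rmult_integral in Hker as [|]; lra. }
  intros k. destruct (le_lt_dec K k); [apply Hhigh; assumption|].
  apply (H (K - k)%nat). lia.
Qed.

(* [jcoef s be n k] is the coefficient of [u^k] in [P_n^(be, al) (1 - 2 u)],
   where [s = al + be + 1]. *)
Definition jcoef (s be : R) (n k : nat) : R :=
  poch (be + 1) n / INR (fact n)
  * (poch (- INR n) k * poch (INR n + s) k / (poch (be + 1) k * INR (fact k))).

Lemma jcoef_high s be n k : (n < k)%nat -> jcoef s be n k = 0.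
Proof. intros H. unfold jcoef. rewrite poch_opp_zero by exact H. unfold Rdiv. ring. Qed.

Lemma jacobi_op_jcoef s be K n k : 0 <= be ->
  jacobi_op s be K (jcoef s be n) k
  = (K - INR n) * (K + INR n + s) * jcoef s be n k.
Proof.
  intros Hbe. unfold jacobi_op, jcoef. simpl poch.
  rewrite fact_S.
  pose proof (poch_pos (be + 1) k ltac:(lra)). pose proof (INR_fact_pos k).
  pose proof (INR_fact_pos n). pose proof (pos_INR k).
  field. repeat split; lra.
Qed.

Lemma jacobi_op_sum s be K (c : nat -> R) (e : nat -> nat -> R) N k :
  jacobi_op s be K (fun k => sum_f_R0 (fun i => c i * e i k) N) k
  = sum_f_R0 (fun i => c i * jacobi_op s be K (e i) k) N.
Proof.
  unfold jacobi_op.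
  rewrite <- !sum_f_R0_scal, <- plus_sum. apply sum_eq. intros; ring.
Qed.

(** The weights absorb the factors [i (i + al)] and [j (j + be)]. Two choices of [phi] matter:
    [(-1)^i], for which the right-hand side vanishes, and [(1 - v)^i v^j], which reproduces
    itself. *)
Lemma jacobi_op_bateman (al be : nat) (phi : nat -> nat -> R) K k :
  jacobi_op (INR al + INR be + 1) (INR be) (INR (S K))
    (fun k => asum (fun i j => bateman_weight al be i j * phi i j * bern i j k)
                   (S K)) k
  = asum (fun i j => bateman_weight al be i j
                     * (phi (S i) j + phi i (S j)) * bern i j k) K.
Proof.
  unfold asum at 1. rewrite jacobi_op_sum.
  rewrite (sum_eq _ (fun i => (fun i j => bateman_weight al be i j * phi i j
      * (INR i * (INR i + INR al) * bern (pred i) j k)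
      + bateman_weight al be i j * phi i j
      * (INR j * (INR j + INR be) * bern i (pred j) k)) i (S K - i)%nat)).
  2:{ intros i Hi. cbv beta.
      replace (INR (S K)) with (INR (i + (S K - i))) by (f_equal; lia).
      rewrite jacobi_op_bern. ring. }
  change (asum (fun i j => bateman_weight al be i j * phi i j
      * (INR i * (INR i + INR al) * bern (pred i) j k)
      + bateman_weight al be i j * phi i j
      * (INR j * (INR j + INR be) * bern i (pred j) k)) (S K) =
    asum (fun i j => bateman_weight al be i j
                     * (phi (S i) j + phi i (S j)) * bern i j k) K).
  rewrite (asum_raise (fun i j => bateman_weight al be i j * phi i j
      * (INR i * (INR i + INR al) * bern (pred i) j k))
      (fun i j => bateman_weight al be i j * phi i j
      * (INR j * (INR j + INR be) * bern i (pred j) k)))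
    by (intros; simpl (INR 0); ring).
  apply asum_ext. intros i j _. cbn [pred]. unfold bateman_weight.
  rewrite !Nat.add_succ_r, !fact_S, !plus_INR, !S_INR.
  pose proof (pos_INR i). pose proof (pos_INR j).
  pose proof (pos_INR al). pose proof (pos_INR be).
  field. repeat split; try apply INR_fact_neq_0; lra.
Qed.

(** Chu-Vandermonde at two negative integers; every term then has the sign [(-1)^K], which
    cancels. *)
Lemma bateman_weight_sum (al be K : nat) :
  asum (bateman_weight al be) K
  = INR (fact (2 * K + al + be))
    / (INR (fact K) * INR (fact (K + al + be))
       * INR (fact (K + al)) * INR (fact (K + be))).
Proof.
  pose proof (chu_vandermonde (- INR (K + be)) (- INR (K + al)) K) as H.
  replace (- INR (K + be) + - INR (K + al)) with (- INR (2 * K + al + be)) in H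
    by (rewrite !plus_INR, mult_INR; simpl; ring).
  rewrite poch_opp in H by lia.
  replace (2 * K + al + be - K)%nat with (K + al + be)%nat in H by lia.
  pose proof (pow_nonzero (-1) K ltac:(lra)) as Hs.
  apply (Rmult_eq_reg_l ((-1) ^ K * INR (fact (K + al)) * INR (fact (K + be)))).
  2:{ repeat apply Rmult_integral_contrapositive_currified;
      try apply INR_fact_neq_0; exact Hs. }
  transitivity ((-1) ^ K * (INR (fact (2 * K + al + be)) /
     INR (fact (K + al + be))) / INR (fact K)).
  2:{ field. repeat split; apply INR_fact_neq_0. }
  rewrite <- H. unfold asum. rewrite <- sum_f_R0_scal. apply sum_eq.
  intros i Hi. rewrite !poch_opp by lia. unfold bateman_weight.
  replace (K + be - i)%nat with (be + (K - i))%nat by lia.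
  replace (K + al - (K - i))%nat with (al + i)%nat by lia.
  replace ((-1) ^ K) with ((-1) ^ i * (-1) ^ (K - i))
    by (rewrite <- pow_add; f_equal; lia).
  field. repeat split; apply INR_fact_neq_0.
Qed.

(** The radicand in [Upsilon]. *)
Definition jnorm (al be n : nat) : R :=
  INR (2 * n + al + be + 1) * INR (fact (n + al + be)) * INR (fact n)
  / (INR (fact (n + al)) * INR (fact (n + be))).

(** Up to a power of 2, [jnorm] times the coefficient of index [K - n] in the series of
    [I_(al+be+2n+1)]. *)
Definition bateman_coef (al be K n : nat) : R :=
  jnorm al be n / (INR (fact (K - n)) * INR (fact (al + be + n + K + 1))).

Lemma bateman_coef_lower (al be K n : nat) : (n <= K)%nat ->
  bateman_coef al be (S K) n
  * ((INR (S K) - INR n) * (INR (S K) + INR n + (INR al + INR be + 1)))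
  = bateman_coef al be K n.
Proof.
  intros Hn. unfold bateman_coef.
  replace (S K - n)%nat with (S (K - n)) by lia.
  replace (al + be + n + S K + 1)%nat with (S (al + be + n + K + 1)) by lia.
  rewrite !fact_S, minus_INR, !plus_INR, (S_INR K) by lia. simpl (INR 1).
  pose proof (pos_INR n). pose proof (le_INR _ _ Hn).
  pose proof (pos_INR al). pose proof (pos_INR be).
  field. repeat split; try apply INR_fact_neq_0; lra.
Qed.

(** Compares the coefficients of [u^K v^K] in [bateman]: on the left two signs [(-1)^i] cancel, on
    the right only [n = K] reaches this degree. *)
Lemma bateman_lead (al be K : nat) :
  asum (bateman_weight al be) K
  = bateman_coef al be K K * jcoef (INR al + INR be + 1) (INR be) K K
    * jcoef (INR al + INR be + 1) (INR be) K K.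
Proof.
  rewrite bateman_weight_sum. unfold bateman_coef, jnorm, jcoef.
  rewrite poch_opp, !Nat.sub_diag by lia.
  replace (INR K + (INR al + INR be + 1)) with (INR (K + al + be) + 1)
    by (rewrite !plus_INR; ring).
  rewrite !poch_nat.
  replace (K + al + be + K)%nat with (2 * K + al + be)%nat by lia.
  replace (al + be + K + K + 1)%nat with (S (2 * K + al + be)) by lia.
  rewrite fact_S, (plus_INR _ 1), (Nat.add_comm be K). simpl (INR 1).
  change (fact 0) with 1%nat. simpl (INR 1).
  pose proof (pos_INR (2 * K + al + be)).
  pose proof (pow_1_even K) as Hs.
  replace (2 * K)%nat with (K + K)%nat in Hs by lia. rewrite pow_add in Hs.
  transitivity ((-1) ^ K * (-1) ^ K * (INR (fact (2 * K + al + be)) /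
    (INR (fact K) * INR (fact (K + al + be)) * INR (fact (K + al)) *
     INR (fact (K + be))))); [rewrite Hs; ring|].
  field. repeat split; try apply INR_fact_neq_0; lra.
Qed.

Definition jval (s be : R) (n : nat) (v : R) : R :=
  sum_f_R0 (fun k => jcoef s be n k * v ^ k) n.

(** The coefficient of [u^K] in [bateman]. As a polynomial in [v] the left-hand side is annihilated
    by [jacobi_op], so it is a multiple of the Jacobi polynomial of degree [K]; [bateman_lead] gives
    the multiple. *)
Lemma bateman_top (al be K : nat) v :
  asum (fun i j => bateman_weight al be i j * ((-1) ^ i * ((1 - v) ^ i * v ^ j))) K
  = bateman_coef al be K K * jcoef (INR al + INR be + 1) (INR be) K K
    * jval (INR al + INR be + 1) (INR be) K v.
Proof.
  set (s := INR al + INR be + 1).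
  set (e := fun k =>
    1 * asum (fun i j => bateman_weight al be i j * (-1) ^ i * bern i j k) K
    + (- (bateman_coef al be K K * jcoef s (INR be) K K)) * jcoef s (INR be) K k).
  assert (He : forall k, e k = 0).
  { apply (jacobi_op_kernel s (INR be) K).
    - unfold s. pose proof (pos_INR al). pose proof (pos_INR be). lra.
    - intros k Hk. unfold e.
      destruct (Nat.eq_dec k K) as [->|].
      + rewrite (asum_ext _ (bateman_weight al be)).
        * rewrite bateman_lead. fold s. ring.
        * intros i j Hij. rewrite bern_top by lia.
          pose proof (pow_1_even i) as Hs.
          replace (2 * i)%nat with (i + i)%nat in Hs by lia.
          rewrite pow_add in Hs. rewrite Rmult_assoc, Hs. ring.
      + rewrite (jcoef_high _ _ K k) by lia. unfold asum.
        rewrite sum_f_R0_zero; [ring|].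
        intros i Hi. rewrite bern_high by lia. ring.
    - intros k. unfold e.
      transitivity (1 * jacobi_op s (INR be) (INR K) (fun k =>
          asum (fun i j => bateman_weight al be i j * (-1) ^ i * bern i j k) K) k
        + - (bateman_coef al be K K * jcoef s (INR be) K K)
          * jacobi_op s (INR be) (INR K) (jcoef s (INR be) K) k);
        [unfold jacobi_op; ring|].
      rewrite jacobi_op_jcoef by apply pos_INR.
      replace (jacobi_op s (INR be) (INR K) (fun k => asum _ K) k) with 0; [ring|].
      destruct K as [|K].
      + unfold asum, jacobi_op. simpl. destruct k; simpl; ring.
      + unfold s. rewrite (jacobi_op_bateman al be (fun i _ => (-1) ^ i)).
        symmetry. apply sum_f_R0_zero. intros i Hi. simpl. ring. }
  transitivity (sum_f_R0 (fun k =>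
    asum (fun i j => bateman_weight al be i j * (-1) ^ i * bern i j k) K * v ^ k) K).
  { unfold asum.
    rewrite (sum_eq (fun k => _ * v ^ k) (fun k => sum_f_R0 (fun i =>
      bateman_weight al be i (K - i) * (-1) ^ i * (bern i (K - i) k * v ^ k)) K)).
    2:{ intros k Hk. rewrite Rmult_comm, <- sum_f_R0_scal.
        apply sum_eq; intros; ring. }
    rewrite sum_f_R0_swap. apply sum_eq. intros i Hi.
    rewrite sum_f_R0_scal, bern_eval by lia. ring. }
  unfold jval. rewrite <- sum_f_R0_scal. apply sum_eq. intros k Hk.
  specialize (He k). unfold e in He.
  replace (asum (fun i j => bateman_weight al be i j * (-1) ^ i * bern i j k) K)
    with (bateman_coef al be K K * jcoef s (INR be) K K * jcoef s (INR be) K k)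
    by lra.
  fold s. ring.
Qed.

(* [jacobi_op] lowers either side from degree [S K] to degree [K], so by
   induction the difference lies in its kernel, hence is determined by its
   leading coefficient, which [bateman_top] shows to be zero. *)
Lemma bateman_coeffs (al be K : nat) v : forall k,
  asum (fun i j => bateman_weight al be i j * ((1 - v) ^ i * v ^ j) * bern i j k) K
  = sum_f_R0 (fun n => bateman_coef al be K n
      * jval (INR al + INR be + 1) (INR be) n v
      * jcoef (INR al + INR be + 1) (INR be) n k) K.
Proof.
  set (s := INR al + INR be + 1).
  set (L := fun K k =>
    asum (fun i j => bateman_weight al be i j * ((1 - v) ^ i * v ^ j) * bern i j k) K).
  set (M := fun K k =>
    sum_f_R0 (fun n => bateman_coef al be K n * jval s (INR be) n v
                       * jcoef s (INR be) n k) K).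
  change (forall k, L K k = M K k).
  assert (Hs : 0 < s)
    by (unfold s; pose proof (pos_INR al); pose proof (pos_INR be); lra).
  assert (HL : forall K, L K K = M K K).
  { intros K'. unfold L, M.
    transitivity (bateman_coef al be K' K' * jcoef s (INR be) K' K'
                  * jval s (INR be) K' v).
    - unfold s. rewrite <- bateman_top. apply asum_ext. intros i j Hij.
      rewrite bern_top by lia. ring.
    - destruct K' as [|K']; [simpl; ring|].
      rewrite tech5, sum_f_R0_zero; [ring|].
      intros i Hi. rewrite jcoef_high by lia. ring. }
  assert (Hhigh : forall K k, (K <= k)%nat -> L K k - M K k = 0).
  { intros K' k Hk. destruct (Nat.eq_dec K' k) as [->|]; [rewrite HL; ring|].
    unfold L, M, asum. rewrite !sum_f_R0_zero; [ring| |];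
      intros i Hi; [rewrite jcoef_high by lia | rewrite bern_high by lia]; ring. }
  induction K as [|K IH]; intros k.
  { specialize (Hhigh 0%nat k ltac:(lia)). lra. }
  apply Rminus_diag_uniq. revert k.
  apply (jacobi_op_kernel s (INR be) (S K)); [exact Hs | apply Hhigh |].
  intros k.
  transitivity (jacobi_op s (INR be) (INR (S K)) (L (S K)) k
                - jacobi_op s (INR be) (INR (S K)) (M (S K)) k);
    [unfold jacobi_op; ring|].
  unfold L, M. rewrite jacobi_op_sum. unfold s.
  rewrite (jacobi_op_bateman al be (fun i j => (1 - v) ^ i * v ^ j)). fold s.
  apply Rminus_diag_eq. specialize (IH k). unfold L, M in IH.
  rewrite tech5.
  transitivity (asum (fun i j => bateman_weight al be i j
                 * ((1 - v) ^ i * v ^ j) * bern i j k) K).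
  { apply asum_ext. intros i j _. simpl. ring. }
  rewrite IH, jacobi_op_jcoef by apply pos_INR.
  rewrite Rminus_diag, !Rmult_0_l, Rmult_0_r, Rplus_0_r.
  apply sum_eq. intros n Hn. rewrite jacobi_op_jcoef by apply pos_INR.
  rewrite <- (bateman_coef_lower al be K n Hn). fold s. ring.
Qed.

(** To be used with [u = sin t ^ 2] and [v = sin t' ^ 2], which makes the two bases the squares of
    [cos t cos t'] and [sin t sin t']. *)
Lemma bateman (al be K : nat) u v :
  asum (fun i j => bateman_weight al be i j
                   * ((1 - u) * (1 - v)) ^ i * (u * v) ^ j) K
  = sum_f_R0 (fun n => bateman_coef al be K n
      * (jval (INR al + INR be + 1) (INR be) n u
         * jval (INR al + INR be + 1) (INR be) n v)) K.
Proof.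
  set (s := INR al + INR be + 1).
  transitivity (sum_f_R0 (fun k => asum (fun i j => bateman_weight al be i j
      * ((1 - v) ^ i * v ^ j) * bern i j k) K * u ^ k) K).
  - unfold asum.
    rewrite (sum_eq (fun k => _ * u ^ k) (fun k => sum_f_R0 (fun i =>
      bateman_weight al be i (K - i) * ((1 - v) ^ i * v ^ (K - i))
      * (bern i (K - i) k * u ^ k)) K)).
    2:{ intros k Hk. rewrite Rmult_comm, <- sum_f_R0_scal.
        apply sum_eq; intros; ring. }
    rewrite sum_f_R0_swap. apply sum_eq. intros i Hi.
    rewrite sum_f_R0_scal, bern_eval by lia. rewrite !Rpow_mult_distr. ring.
  - rewrite (sum_eq _ (fun k => sum_f_R0 (fun n => bateman_coef al be K n
      * jval s (INR be) n v * (jcoef s (INR be) n k * u ^ k)) K)).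
    2:{ intros k Hk. rewrite bateman_coeffs, Rmult_comm, <- sum_f_R0_scal.
        fold s. apply sum_eq; intros; ring. }
    rewrite sum_f_R0_swap. apply sum_eq. intros n Hn.
    rewrite sum_f_R0_scal. unfold jval at 2.
    rewrite <- (sum_f_R0_trunc _ n K Hn); [unfold jval; ring|].
    intros k Hk. rewrite jcoef_high by lia. ring.
Qed.

(** * Formal power series and exponential majorants *)

Lemma PS_mult_S a b n :
  PS_mult a b (S n) = a 0%nat * b (S n) + PS_mult (fun k => a (S k)) b n.
Proof. unfold PS_mult. rewrite sum_f_R0_shift. reflexivity. Qed.

Lemma PS_mult_comm a b : PS_mult a b = PS_mult b a.
Proof.
  apply functional_extensionality. intros n.
  enough (H : forall n a b,
    PS_mult a b (S n) = a (S n) * b 0%nat + PS_mult a (fun k => b (S k)) n).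
  { revert a b. induction n as [|n IH]; intros a b.
    - unfold PS_mult. simpl. ring.
    - rewrite PS_mult_S, IH, H. ring. }
  clear. induction n as [|n IH]; intros a b.
  - unfold PS_mult. simpl. ring.
  - rewrite PS_mult_S, IH, (PS_mult_S a). ring.
Qed.

Lemma PS_mult_lin_l c c' a a' b n :
  PS_mult (fun k => c * a k + c' * a' k) b n
  = c * PS_mult a b n + c' * PS_mult a' b n.
Proof.
  unfold PS_mult. rewrite <- sum_f_R0_lin. apply sum_eq. intros; ring.
Qed.

Lemma PS_mult_assoc a b c : PS_mult (PS_mult a b) c = PS_mult a (PS_mult b c).
Proof.
  apply functional_extensionality. intros n. revert a.
  induction n as [|n IH]; intros a; [unfold PS_mult; simpl; ring|].
  rewrite PS_mult_S, (PS_mult_S a (PS_mult b c)), <- IH, (PS_mult_S b c).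
  replace (fun k => PS_mult a b (S k)) with
    (fun k => a 0%nat * b (S k) + 1 * PS_mult (fun k => a (S k)) b k).
  2:{ apply functional_extensionality. intros k. rewrite PS_mult_S. ring. }
  rewrite PS_mult_lin_l. unfold PS_mult at 1. simpl. ring.
Qed.

Definition PS_const_1 (n : nat) : R := if (n =? 0)%nat then 1 else 0.

Lemma PS_mult_1_r a : PS_mult a PS_const_1 = a.
Proof.
  apply functional_extensionality. intros n. rewrite PS_mult_comm.
  destruct n as [|n]; [unfold PS_mult, PS_const_1; simpl; ring|].
  rewrite PS_mult_S. unfold PS_mult. rewrite sum_f_R0_zero.
  - unfold PS_const_1. simpl. ring.
  - intros i Hi. unfold PS_const_1. simpl. ring.
Qed.

Definition exp_coef (a : R) (k : nat) : R := a ^ k / INR (fact k).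

Lemma exp_coef_0 : exp_coef 0 = PS_const_1.
Proof.
  apply functional_extensionality. intros [|k]; unfold exp_coef, PS_const_1;
    simpl; [field|]. unfold Rdiv. ring.
Qed.

Lemma exp_coef_pos a k : 0 <= a -> 0 <= exp_coef a k.
Proof.
  intros Ha. apply Rdiv_le_0_compat; [apply pow_le; exact Ha | apply INR_fact_pos].
Qed.

Lemma exp_coef_le a b k : 0 <= a <= b -> exp_coef a k <= exp_coef b k.
Proof.
  intros Ha. apply Rmult_le_compat_r;
    [left; apply Rinv_0_lt_compat, INR_fact_pos | apply pow_incr; exact Ha].
Qed.

Lemma exp_coef_plus a b : PS_mult (exp_coef a) (exp_coef b) = exp_coef (a + b).
Proof.
  apply functional_extensionality. intros n. unfold exp_coef at 3.
  rewrite binomial. unfold PS_mult, Rdiv.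
  rewrite Rmult_comm, <- sum_f_R0_scal. apply sum_eq. intros i Hi.
  unfold exp_coef, Binomial.C. field. repeat split; apply INR_fact_neq_0.
Qed.

Lemma exp_coef_abs a k : Rabs (exp_coef a k) = exp_coef (Rabs a) k.
Proof.
  unfold exp_coef, Rdiv.
  rewrite Rabs_mult, Rabs_inv, RPow_abs, (Rabs_pos_eq (INR _)); [reflexivity|].
  left. apply INR_fact_pos.
Qed.

(** Majorization by [exp (a z)]. Under products the rates add, so a single number controls a whole
    frontier. *)
Definition exp_bounded (a : R) (f : nat -> R) : Prop :=
  forall k, Rabs (f k) <= exp_coef a k.

Lemma PS_mult_abs_le f g f' g' :
  (forall k, Rabs (f k) <= f' k) -> (forall k, Rabs (g k) <= g' k) ->
  forall k, Rabs (PS_mult f g k) <= PS_mult f' g' k.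
Proof.
  intros Hf Hg k. unfold PS_mult. eapply Rle_trans; [apply sum_f_R0_triangle|].
  apply sum_Rle. intros i Hi. rewrite Rabs_mult.
  apply Rmult_le_compat; auto using Rabs_pos.
Qed.

Lemma exp_bounded_mult a b f g :
  exp_bounded a f -> exp_bounded b g -> exp_bounded (a + b) (PS_mult f g).
Proof.
  intros Hf Hg k. rewrite <- exp_coef_plus. apply PS_mult_abs_le; assumption.
Qed.

Lemma exp_bounded_exp a b : Rabs a <= b -> exp_bounded b (exp_coef a).
Proof.
  intros Ha k. rewrite exp_coef_abs. apply exp_coef_le. split; [apply Rabs_pos|exact Ha].
Qed.

(** * Series of modified Bessel functions *)

(* [spread l A] is the coefficient sequence of [z^l A(z^2)]. *)
Definition spread (l : nat) (A : nat -> R) (k : nat) : R :=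
  if ((l <=? k)%nat && Nat.even (k - l))%bool then A (Nat.div2 (k - l)) else 0.

Lemma spread_at l A j : spread l A (l + 2 * j) = A j.
Proof.
  unfold spread. replace (l + 2 * j - l)%nat with (2 * j)%nat by lia.
  rewrite Nat.even_mul, Nat.div2_double, (proj2 (Nat.leb_le _ _)) by lia.
  reflexivity.
Qed.

Lemma spread_off l A k : (forall j, k <> l + 2 * j)%nat -> spread l A k = 0.
Proof.
  intros H. unfold spread. destruct (Nat.leb_spec l k); [|reflexivity].
  destruct (Nat.even (k - l)) eqn:E; [|reflexivity]. exfalso.
  apply Nat.even_spec in E as [j Hj]. apply (H j). lia.
Qed.

Lemma spread_cases l k : (exists j, k = (l + 2 * j)%nat) \/ (forall j, k <> l + 2 * j)%nat.
Proof.
  destruct (le_lt_dec l k) as [Hlk|]; [|right; lia].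
  destruct (Nat.Even_or_Odd (k - l)) as [[j Hj]|[j Hj]]; [left; exists j|right]; lia.
Qed.

Lemma spread_0_SS A k : spread 0 A (S (S k)) = spread 0 (fun j => A (S j)) k.
Proof. unfold spread. rewrite !Nat.sub_0_r. reflexivity. Qed.

Lemma PS_mult_shift a b c d :
  a 0%nat = 0 -> d 0%nat = 0 -> (forall k, a (S k) = b k) ->
  (forall k, d (S k) = PS_mult b c k) -> PS_mult a c = d.
Proof.
  intros Ha Hd Hab Hdb. apply functional_extensionality. intros [|k].
  - unfold PS_mult. simpl. rewrite Ha, Hd. ring.
  - rewrite PS_mult_S, Ha, Hdb.
    replace (fun k => a (S k)) with b by (apply functional_extensionality; auto).
    ring.
Qed.

(** Induction strips off [z^l] and [z^m]. The remaining even series are compared two degrees at a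
    time, their coefficients of degree 1 being zero. *)
Lemma PS_mult_spread l m A B :
  PS_mult (spread l A) (spread m B) = spread (l + m) (PS_mult A B).
Proof.
  induction l as [|l IH].
  2:{ apply (PS_mult_shift _ (spread l A)); try reflexivity.
      intros k. rewrite IH. reflexivity. }
  induction m as [|m IH].
  2:{ rewrite (PS_mult_comm (spread 0 A)).
      apply (PS_mult_shift _ (spread m B)); try reflexivity.
      intros k. rewrite (PS_mult_comm (spread m B)), IH. reflexivity. }
  apply functional_extensionality. intros k. simpl.
  enough (H : forall n k A, (k < n)%nat ->
    PS_mult (spread 0 A) (spread 0 B) k = spread 0 (PS_mult A B) k)
    by (apply (H (S k)); lia).
  clear. induction n as [|n IH]; intros k A Hk; [lia|].
  destruct k as [|[|k]]; [unfold PS_mult, spread; simpl; ring ..|].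
  rewrite !PS_mult_S. cbv beta.
  replace (fun k => spread 0 A (S (S k))) with (spread 0 (fun j => A (S j)))
    by (apply functional_extensionality; intros; symmetry; apply spread_0_SS).
  rewrite IH by lia.
  rewrite !spread_0_SS.
  change (spread 0 A 1) with 0. change (spread 0 A 0) with (A 0%nat).
  rewrite Rmult_0_l, Rplus_0_l.
  destruct (spread_cases 0 k) as [[j ->]|Hoff].
  - rewrite !spread_at, PS_mult_S. reflexivity.
  - rewrite !spread_off by exact Hoff. ring.
Qed.

(* The coefficient of [z^k] in [I_(l + h)(a z) / (a z)^h]. *)
Definition bessel_coef (h l : nat) (a : R) : nat -> R :=
  spread l (fun j => a ^ (l + 2 * j)
    / (2 ^ (l + 2 * j + h) * INR (fact j) * INR (fact (l + j + h)))).

Lemma pow_2_pos n : 0 < 2 ^ n.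
Proof. apply pow_lt. lra. Qed.

Lemma bessel_coef_pos h l a k : 0 <= a -> 0 <= bessel_coef h l a k.
Proof.
  intros Ha. unfold bessel_coef.
  destruct (spread_cases l k) as [[j ->]|Hoff];
    [rewrite spread_at | rewrite spread_off by exact Hoff; lra].
  apply Rdiv_le_0_compat; [apply pow_le; exact Ha|].
  repeat apply Rmult_lt_0_compat; auto using pow_2_pos, INR_fact_pos.
Qed.

Lemma bessel_coef_low h l a k : (k < l)%nat -> bessel_coef h l a k = 0.
Proof. intros Hk. apply spread_off. lia. Qed.

(** A binomial coefficient is at most a power of 2, by Pascal's rule. The powers of 2 in the Bessel
    series thereby pay for an exponential majorant of the same rate. *)
Lemma fact_plus_le i j : (fact (i + j) <= 2 ^ (i + j) * (fact i * fact j))%nat.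
Proof.
  enough (H : forall n i j, (i + j = n)%nat ->
    (fact (i + j) <= 2 ^ (i + j) * (fact i * fact j))%nat) by eauto.
  clear. induction n as [|n IH]; intros i j Hij.
  - replace i with 0%nat by lia. replace j with 0%nat by lia. simpl. lia.
  - pose proof (fun m => Nat.pow_nonzero 2 m ltac:(lia)).
    destruct i as [|i]; [simpl; specialize (H j); nia|].
    destruct j as [|j];
      [rewrite Nat.add_0_r; simpl fact at 3; specialize (H (S i)); nia|].
    pose proof (IH i (S j) ltac:(lia)) as H1. pose proof (IH (S i) j ltac:(lia)) as H2.
    replace (S i + S j)%nat with (S (i + S j)) by lia.
    replace (S i + j)%nat with (i + S j)%nat in H2 by lia.
    rewrite fact_simpl, Nat.pow_succ_r'.
    set (p := (2 ^ (i + S j))%nat) in *. set (f := fact (i + S j)) in *.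
    transitivity (S i * f + S j * f)%nat; [nia|].
    transitivity (S i * (p * (fact i * fact (S j))) + S j * (p * (fact (S i) * fact j)))%nat;
      [nia|].
    rewrite !fact_simpl. nia.
Qed.

Lemma exp_bounded_bessel h l a : 0 <= a -> exp_bounded a (bessel_coef h l a).
Proof.
  intros Ha k. rewrite Rabs_pos_eq by (apply bessel_coef_pos; exact Ha).
  unfold bessel_coef.
  destruct (spread_cases l k) as [[j ->]|Hoff];
    [rewrite spread_at | rewrite spread_off by exact Hoff; apply exp_coef_pos; exact Ha].
  apply Rmult_le_compat_l; [apply pow_le; exact Ha|].
  apply Rinv_le_contravar; [apply INR_fact_pos|].
  pose proof (fact_plus_le (l + j) j) as H.
  replace (l + j + j)%nat with (l + 2 * j)%nat in H by lia.
  apply le_INR in H. rewrite !mult_INR, pow_INR in H.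
  replace (INR 2) with 2 in H by (simpl; ring).
  eapply Rle_trans; [exact H|]. rewrite Rmult_assoc.
  apply Rmult_le_compat; try apply Rmult_le_pos; try apply pos_INR;
    [left; apply pow_2_pos | apply Rle_pow; [lra|lia] |].
  rewrite Rmult_comm. apply Rmult_le_compat_l; [apply pos_INR|].
  apply le_INR, fact_le. lia.
Qed.

(** Both sides live in the degrees [l + m + 2 K], and there the identity is [bateman] for the orders
    [l + h] and [m + h] in degree [K]. *)
Lemma bessel_coef_product (h l m k : nat) (a X Y u v : R) :
  X ^ 2 = (1 - u) * (1 - v) -> Y ^ 2 = u * v ->
  PS_mult (bessel_coef h l (a * X)) (bessel_coef h m (a * Y)) k
  = 2 * sum_f_R0 (fun n =>
      jnorm (l + h) (m + h) n * X ^ l * Y ^ m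
      * (jval (INR (l + h) + INR (m + h) + 1) (INR (m + h)) n u
         * jval (INR (l + h) + INR (m + h) + 1) (INR (m + h)) n v)
      * bessel_coef (2 * h + 1) (2 * n + l + m) a k) k.
Proof.
  intros HX HY. unfold bessel_coef at 1 2. rewrite PS_mult_spread.
  destruct (spread_cases (l + m) k) as [[K ->]|Hoff].
  2:{ rewrite spread_off by exact Hoff. rewrite sum_f_R0_zero; [ring|].
      intros n _. unfold bessel_coef. rewrite spread_off; [ring|].
      intros j Hj. apply (Hoff (n + j)%nat). lia. }
  rewrite spread_at.
  (* The sum is stated up to [k], independently of parity, because [laplace_sum] expects this
     triangular shape. *)
  rewrite (sum_f_R0_trunc _ K); [| lia |].
  2:{ intros n Hn. rewrite bessel_coef_low by lia. ring. }
  set (g := a ^ (l + m + 2 * K) / 2 ^ (l + m + 2 * K + 2 * h) * X ^ l * Y ^ m).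
  transitivity (g * asum (fun i j => bateman_weight (l + h) (m + h) i j
     * ((1 - u) * (1 - v)) ^ i * (u * v) ^ j) K).
  - unfold asum, PS_mult. rewrite <- sum_f_R0_scal. apply sum_eq. intros i Hi.
    unfold g, bateman_weight. rewrite <- HX, <- HY, <- !pow_mult.
    replace (l + h + i)%nat with (l + i + h)%nat by lia.
    replace (m + h + (K - i))%nat with (m + (K - i) + h)%nat by lia.
    rewrite !Rpow_mult_distr.
    replace (l + m + 2 * K)%nat with ((l + 2 * i) + (m + 2 * (K - i)))%nat by lia.
    replace ((l + 2 * i) + (m + 2 * (K - i)) + 2 * h)%nat
      with ((l + 2 * i + h) + (m + 2 * (K - i) + h))%nat by lia.
    rewrite (pow_add a (l + 2 * i) (m + 2 * (K - i))), (pow_add 2 (l + 2 * i + h)), (pow_add X), (pow_add Y).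
    field. repeat split; try apply INR_fact_neq_0; apply pow_nonzero; lra.
  - rewrite bateman, <- !sum_f_R0_scal. apply sum_eq. intros n Hn.
    replace (l + m + 2 * K)%nat with ((2 * n + l + m) + 2 * (K - n))%nat by lia.
    unfold bessel_coef. rewrite spread_at. unfold g, bateman_coef.
    replace (2 * n + l + m + 2 * (K - n))%nat with (l + m + 2 * K)%nat by lia.
    replace (2 * n + l + m + (K - n) + (2 * h + 1))%nat
      with (l + h + (m + h) + n + K + 1)%nat by lia.
    (* The order offset [2 h + 1] brings one more power of 2 than the two factors with offset [h]:
       this is the factor 2 in the statement. *)
    replace (l + m + 2 * K + (2 * h + 1))%nat
      with (S (l + m + 2 * K + 2 * h)) by lia.
    rewrite <- (tech_pow_Rmult 2 (l + m + 2 * K + 2 * h)).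
    field. repeat split; try apply INR_fact_neq_0; apply pow_nonzero; lra.
Qed.

Lemma bessel_coef_scal m a k : bessel_coef 0 m a k = a ^ k * bessel_coef 0 m 1 k.
Proof.
  unfold bessel_coef. destruct (spread_cases m k) as [[j ->]|Hoff].
  - rewrite !spread_at, pow1. field.
    repeat split; try apply INR_fact_neq_0; apply pow_nonzero; lra.
  - rewrite !spread_off by exact Hoff. ring.
Qed.

(** The rule [I_0' = I_1] on coefficients. *)
Lemma bessel_coef_rec_0 k :
  (INR k + 1) * bessel_coef 0 0 1 (S k) = bessel_coef 0 1 1 k.
Proof.
  unfold bessel_coef. destruct (spread_cases 1 k) as [[j ->]|Hoff].
  - rewrite spread_at. replace (S (1 + 2 * j)) with (0 + 2 * S j)%nat by lia.
    rewrite spread_at, !pow1.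
    replace (1 + j + 0)%nat with (S j) by lia.
    replace (0 + S j + 0)%nat with (S j) by lia.
    replace (0 + 2 * S j + 0)%nat with (S (1 + 2 * j + 0)) by lia.
    rewrite <- (tech_pow_Rmult 2 (1 + 2 * j + 0)).
    rewrite !fact_S, plus_INR, mult_INR. simpl (INR 1). simpl (INR 2).
    pose proof (pos_INR j).
    field. repeat split; try apply INR_fact_neq_0; try (apply pow_nonzero; lra); lra.
  - rewrite !spread_off; [ring | exact Hoff |].
    intros [|j] Hj; [lia|]. apply (Hoff j). lia.
Qed.

(** The rule [2 I_(m+1)' = I_m + I_(m+2)] on coefficients. *)
Lemma bessel_coef_rec_S m k :
  2 * (INR k + 1) * bessel_coef 0 (S m) 1 (S k)
  = bessel_coef 0 m 1 k + bessel_coef 0 (S (S m)) 1 k.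
Proof.
  unfold bessel_coef. destruct (spread_cases m k) as [[j ->]|Hoff].
  - replace (S (m + 2 * j)) with (S m + 2 * j)%nat by lia.
    rewrite !spread_at, !pow1.
    destruct j as [|j].
    + rewrite (spread_off (S (S m))) by lia.
      rewrite !Nat.mul_0_r, !Nat.add_0_r. rewrite fact_S, <- tech_pow_Rmult.
      pose proof (pos_INR m). simpl (INR (fact 0)).
      field. repeat split; try apply INR_fact_neq_0; try (apply pow_nonzero; lra); lra.
    + replace (m + 2 * S j)%nat with (S (S m) + 2 * j)%nat at 3 by lia.
      rewrite spread_at, !pow1.
      replace (S m + 2 * S j + 0)%nat with (S (S (S (m + 2 * j)))) by lia.
      replace (m + 2 * S j + 0)%nat with (S (S (m + 2 * j))) by lia.
      replace (S (S m) + 2 * j + 0)%nat with (S (S (m + 2 * j))) by lia.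
      replace (S m + S j + 0)%nat with (S (S (m + j))) by lia.
      replace (m + S j + 0)%nat with (S (m + j)) by lia.
      replace (S (S m) + j + 0)%nat with (S (S (m + j))) by lia.
      replace (m + 2 * S j)%nat with (m + j + j + 2)%nat by lia.
      rewrite !fact_S, <- (tech_pow_Rmult 2 (S (S (m + 2 * j)))), !S_INR, !plus_INR.
      replace (INR 2) with 2 by (simpl; ring).
      pose proof (pos_INR m). pose proof (pos_INR j).
      field. repeat split; try apply INR_fact_neq_0; try (apply pow_nonzero; lra); lra.
  - rewrite !spread_off; [ring | | exact Hoff |]; intros j Hj.
    + apply (Hoff (S j)). lia.
    + apply (Hoff j). lia.
Qed.

Lemma cos_INR_S m t :
  cos (INR (S (S m)) * t) + cos (INR m * t) = 2 * cos t * cos (INR (S m) * t).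
Proof.
  rewrite form1, !S_INR.
  replace ((_ - _) / 2) with t by field.
  replace ((_ + _) / 2) with ((INR m + 1) * t) by field. reflexivity.
Qed.

(** Multiplying the coefficient of degree [k + 1] by [k + 1] is differentiation, and both sides
    satisfy [f' = cos t f]: on the left, the derivative rules for [I_m] match the addition formula
    [cos_INR_S]. *)
Lemma jacobi_anger t k :
  sum_f_R0 (fun m => neumann m * cos (INR m * t) * bessel_coef 0 m 1 k) k
  = exp_coef (cos t) k.
Proof.
  induction k as [|k IH].
  { simpl. unfold neumann, exp_coef, bessel_coef, spread. simpl.
    rewrite Rmult_0_l, cos_0. field. }
  apply (Rmult_eq_reg_l (INR k + 1)); [|pose proof (pos_INR k); lra].
  set (b := fun m => bessel_coef 0 m 1 k).
  set (c := fun m => cos (INR m * t)).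
  transitivity (cos t * exp_coef (cos t) k).
  2:{ unfold exp_coef. rewrite fact_S. simpl. field.
      split; [apply INR_fact_neq_0 | pose proof (pos_INR k); lra]. }
  rewrite <- IH, <- (sum_f_R0_trunc _ k (S k)); [| lia |].
  2:{ intros i Hi. rewrite bessel_coef_low by exact Hi. ring. }
  rewrite !sum_f_R0_shift.
  rewrite !Rmult_plus_distr_l, <- !sum_f_R0_scal.
  transitivity (b 1%nat + (sum_f_R0 (fun m => c (S m) * b m) k
                           + sum_f_R0 (fun m => c (S m) * b (S (S m))) k)).
  { rewrite <- plus_sum. f_equal.
    - change (neumann 0) with (2 - 1). simpl (INR 0). rewrite Rmult_0_l, cos_0.
      unfold b. rewrite <- bessel_coef_rec_0. ring.
    - apply sum_eq. intros m Hm. change (neumann (S m)) with (2 - 0).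
      unfold b, c. rewrite <- Rmult_plus_distr_l, <- bessel_coef_rec_S. ring. }
  symmetry.
  transitivity (c 1%nat * b 0%nat + (sum_f_R0 (fun m => c (S (S m)) * b (S m)) k
      + sum_f_R0 (fun m => c m * b (S m)) k)).
  { rewrite <- plus_sum. f_equal.
    - change (neumann 0) with (2 - 1). unfold b, c. simpl INR.
      rewrite Rmult_0_l, cos_0, Rmult_1_l. ring.
    - apply sum_eq. intros m Hm. change (neumann (S m)) with (2 - 0).
      unfold b, c.
      replace (cos t * ((2 - 0) * cos (INR (S m) * t) * bessel_coef 0 (S m) 1 k))
        with (2 * cos t * cos (INR (S m) * t) * bessel_coef 0 (S m) 1 k) by ring.
      rewrite <- cos_INR_S. ring. }
  rewrite <- !Rplus_assoc, <- (sum_f_R0_shift (fun m => c (S m) * b m)).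
  simpl sum_f_R0 at 1.
  replace (b (S k)) with 0 by (symmetry; apply bessel_coef_low; lia).
  assert (Hc : sum_f_R0 (fun m => c m * b (S m)) k
    = b 1%nat + sum_f_R0 (fun m => c (S m) * b (S (S m))) k).
  { rewrite <- (sum_f_R0_trunc _ k (S k)); [| lia |].
    - rewrite sum_f_R0_shift. unfold c at 1. simpl (INR 0).
      rewrite Rmult_0_l, cos_0. ring.
    - intros i Hi. unfold b. rewrite bessel_coef_low by lia. ring. }
  rewrite Hc. ring.
Qed.

Lemma bessel_coef_fourier a t k :
  sum_f_R0 (fun m => neumann m * cos (INR m * t) * bessel_coef 0 m a k) k
  = exp_coef (a * cos t) k.
Proof.
  unfold exp_coef. rewrite Rpow_mult_distr.
  transitivity (a ^ k * exp_coef (cos t) k); [|unfold exp_coef, Rdiv; ring].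
  rewrite <- jacobi_anger, <- sum_f_R0_scal. apply sum_eq. intros m Hm.
  rewrite (bessel_coef_scal m a). ring.
Qed.

(** * Euler's transformation and the Legendre function *)

Lemma is_lim_seq_ratio (a c : R) : 0 < c ->
  is_lim_seq (fun n => (INR n + a) / (INR n + c)) 1.
Proof.
  intros Hc.
  apply (is_lim_seq_ext (fun n => 1 + (a - c) * / (INR n + c))).
  { intros n. pose proof (pos_INR n). field. lra. }
  replace (Finite 1) with (Finite (1 + (a - c) * 0)) by (f_equal; ring).
  apply is_lim_seq_plus'; [apply is_lim_seq_const|].
  apply (is_lim_seq_scal_l _ (a - c) 0).
  replace (Finite 0) with (Rbar_inv p_infty) by reflexivity.
  apply is_lim_seq_inv; [|discriminate].
  apply (is_lim_seq_plus _ _ p_infty c);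
    [apply is_lim_seq_INR | apply is_lim_seq_const | reflexivity].
Qed.

Lemma Gamma_nat k : Gamma (INR k + 1) = INR (fact k).
Proof.
  unfold Gamma.
  assert (H : is_lim_seq
    (fun n => INR (fact n) * INR n ^ k / INR (fact (n + k))) 1).
  { induction k as [|k IH].
    - apply (is_lim_seq_ext (fun _ => 1)); [|apply is_lim_seq_const].
      intros n. rewrite Nat.add_0_r. simpl. field. apply INR_fact_neq_0.
    - apply (is_lim_seq_ext (fun n => INR (fact n) * INR n ^ k / INR (fact (n + k))
        * ((INR n + 0) / (INR n + (INR k + 1))))).
      + intros n. rewrite Nat.add_succ_r, fact_S, plus_INR. simpl pow.
        pose proof (pos_INR n). pose proof (pos_INR k).
        field. split; [apply INR_fact_neq_0 | lra].
      + replace (Finite 1) with (Finite (1 * 1)) by (f_equal; ring).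
        apply is_lim_seq_mult'; [exact IH|].
        apply is_lim_seq_ratio. pose proof (pos_INR k). lra. }
  replace (INR (fact k)) with (real (INR (fact k))) by reflexivity.
  f_equal. apply is_lim_seq_unique.
  apply (is_lim_seq_ext_loc (fun n => INR (fact k) *
    (INR (fact n) * INR n ^ k / INR (fact (n + k))
     * ((INR n + 0) / (INR n + (INR k + 1)))))).
  (* [Rpower] is a power only for a positive base, so [n = 0] is left out. *)
  { exists 1%nat. intros n Hn.
    replace (INR k + 1) with (INR (S k)) at 2 by apply S_INR.
    rewrite Rpower_pow by (apply lt_0_INR; lia).
    rewrite poch_nat.
    replace (k + S n)%nat with (S (n + k)) by lia.
    rewrite fact_S, plus_INR. simpl pow.
    pose proof (pos_INR n). pose proof (pos_INR k).
    field. repeat split; try apply INR_fact_neq_0; lra. }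
  replace (Finite (INR (fact k))) with (Finite (INR (fact k) * (1 * 1)))
    by (f_equal; ring).
  apply (is_lim_seq_scal_l _ (INR (fact k)) (1 * 1)).
  apply is_lim_seq_mult'; [exact H|].
  apply is_lim_seq_ratio. pose proof (pos_INR k). lra.
Qed.

(** * Hypergeometric series *)

Definition hyp_coef (a b c : R) (n : nat) : R :=
  poch a n * poch b n / (poch c n * INR (fact n)).

Lemma hyp_coef_pos a b c n : 0 < a -> 0 < b -> 0 < c -> 0 < hyp_coef a b c n.
Proof.
  intros. apply Rdiv_lt_0_compat; apply Rmult_lt_0_compat;
    auto using poch_pos, INR_fact_pos.
Qed.

Lemma hyp_coef_sym a b c : hyp_coef a b c = hyp_coef b a c.
Proof.
  apply functional_extensionality. intros n. unfold hyp_coef.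
  rewrite (Rmult_comm (poch a n)). reflexivity.
Qed.

Lemma hyp_coef_S a b c n : 0 < c ->
  (INR n + 1) * (INR n + c) * hyp_coef a b c (S n)
  = (INR n + a) * (INR n + b) * hyp_coef a b c n.
Proof.
  intros Hc. unfold hyp_coef. rewrite fact_S. simpl poch.
  pose proof (poch_pos c n Hc). pose proof (INR_fact_pos n). pose proof (pos_INR n).
  field. repeat split; lra.
Qed.

Lemma CV_radius_hyp a b c : 0 < a -> 0 < b -> 0 < c ->
  CV_radius (hyp_coef a b c) = 1.
Proof.
  intros Ha Hb Hc. replace (Finite 1) with (Finite (/ 1)) by (f_equal; field).
  apply CV_radius_finite_DAlembert; [|lra|].
  { intros n. pose proof (hyp_coef_pos a b c n Ha Hb Hc). lra. }
  apply (is_lim_seq_ext (fun n => (INR n + a) / (INR n + 1)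
                                  * ((INR n + b) / (INR n + c)))).
  - intros n. pose proof (hyp_coef_pos a b c n Ha Hb Hc).
    pose proof (hyp_coef_pos a b c (S n) Ha Hb Hc). pose proof (pos_INR n).
    rewrite Rabs_pos_eq by (left; apply Rdiv_lt_0_compat; assumption).
    pose proof (hyp_coef_S a b c n Hc) as HS.
    apply (Rmult_eq_reg_l ((INR n + 1) * (INR n + c) * hyp_coef a b c n)).
    2:{ apply Rgt_not_eq.
        apply Rmult_lt_0_compat; [apply Rmult_lt_0_compat|]; lra. }
    transitivity ((INR n + a) * (INR n + b) * hyp_coef a b c n); [field; repeat split; lra|].
    rewrite <- HS. field. repeat split; lra.
  - replace (Finite 1) with (Finite (1 * 1)) by (f_equal; ring).
    apply is_lim_seq_mult'; apply is_lim_seq_ratio; lra.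
Qed.

Lemma Series_zero : Series (fun _ => 0) = 0.
Proof.
  rewrite (Series_ext _ (fun _ => 0 * 0)) by (intros; ring).
  rewrite Series_scal_l. ring.
Qed.

Lemma Series_nonneg (a : nat -> R) :
  (forall n, 0 <= a n) -> ex_series a -> 0 <= Series a.
Proof.
  intros Ha Hex. rewrite <- Series_zero. apply Series_le; [|exact Hex].
  intros n. split; [lra | apply Ha].
Qed.

Lemma PSeries_correct_lt a x : Rbar_lt (Rabs x) (CV_radius a) ->
  is_pseries a x (PSeries a x).
Proof.
  intros H. apply PSeries_correct, ex_pseries_R, ex_series_Rabs, CV_disk_inside, H.
Qed.

(** The series of the five terms are added, and each coefficient of the result vanishes by
    [hyp_coef_S]. The equation is solved for the second-order term because that term is substituted
    in [euler_transformation]. *)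
Lemma hyp_ode a b c x : 0 < a -> 0 < b -> 0 < c -> Rabs x < 1 ->
  let h := hyp_coef a b c in
  x * (1 - x) * PSeries (PS_derive (PS_derive h)) x
  = a * b * PSeries h x - (c - (a + b + 1) * x) * PSeries (PS_derive h) x.
Proof.
  intros Ha Hb Hc Hx h.
  assert (Hr : Rbar_lt (Rabs x) (CV_radius h))
    by (unfold h; rewrite CV_radius_hyp by assumption; exact Hx).
  pose proof (PSeries_correct_lt h x Hr) as H0.
  assert (H1 : is_pseries (PS_derive h) x (PSeries (PS_derive h) x))
    by (apply PSeries_correct_lt; rewrite CV_radius_derive; exact Hr).
  assert (H2 : is_pseries (PS_derive (PS_derive h)) x (PSeries (PS_derive (PS_derive h)) x))
    by (apply PSeries_correct_lt; rewrite !CV_radius_derive; exact Hr).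
  pose proof (is_pseries_incr_1 _ _ _ H1) as H1'.
  pose proof (is_pseries_incr_1 _ _ _ H2) as H2'.
  pose proof (is_pseries_incr_1 _ _ _ H2') as H2''.
  rewrite is_pseries_R in H0, H1, H1', H2', H2''.
  set (f0 := PSeries h x) in *. set (f1 := PSeries (PS_derive h) x) in *.
  set (f2 := PSeries (PS_derive (PS_derive h)) x) in *.
  pose proof (is_series_plus _ _ _ _ H2'
    (is_series_plus _ _ _ _ (is_series_scal (-1) _ _ H2'')
      (is_series_plus _ _ _ _ (is_series_scal c _ _ H1)
        (is_series_plus _ _ _ _ (is_series_scal (- (a + b + 1)) _ _ H1')
           (is_series_scal (- (a * b)) _ _ H0))))) as H.
  apply is_series_unique in H.
  assert (Hz : forall n, hyp_coef a b c (S n)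
     = (INR n + a) * (INR n + b) * hyp_coef a b c n / ((INR n + 1) * (INR n + c))).
  { intros n. rewrite <- hyp_coef_S by exact Hc. pose proof (pos_INR n).
    field. split; lra. }
  rewrite (Series_ext _ (fun _ => 0)) in H.
  2:{ intros n. unfold PS_derive, PS_incr_1, plus, scal, zero. simpl.
      unfold mult. simpl. fold h in Hz.
      (* The shifted series have padding zeros in degrees 0 and 1. *)
      destruct n as [|[|n]].
      - rewrite (Hz 0%nat). simpl. field. lra.
      - rewrite (Hz 1%nat), (Hz 0%nat). simpl. field. lra.
      - rewrite (Hz (S (S n))), (Hz (S n)).
        change (match n with 0%nat => 1 | S _ => INR n + 1 end)
          with (INR (S n)).
        rewrite !S_INR. pose proof (pos_INR n). field. lra. }
  rewrite Series_zero in H.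
  unfold plus, scal in H. simpl in H. unfold mult in H. simpl in H. lra.
Qed.

(** Positivity permits the logarithms in [euler_transformation]. *)
Lemma hyp_ge_1 a b c x : 0 < a -> 0 < b -> 0 < c -> 0 <= x < 1 ->
  1 <= PSeries (hyp_coef a b c) x.
Proof.
  intros Ha Hb Hc Hx.
  assert (Hex : ex_series (fun n => hyp_coef a b c n * x ^ n)).
  { apply ex_series_Rabs, CV_disk_inside.
    rewrite CV_radius_hyp by assumption. simpl. rewrite Rabs_pos_eq; lra. }
  unfold PSeries. rewrite Series_incr_1 by exact Hex.
  assert (H0 : 0 <= Series (fun n => hyp_coef a b c (S n) * x ^ S n)).
  { apply Series_nonneg;
      [|exact (proj1 (ex_series_incr_1 (fun n => hyp_coef a b c n * x ^ n)) Hex)].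
    intros n. apply Rmult_le_pos; [left; apply hyp_coef_pos | apply pow_le]; lra. }
  replace (hyp_coef a b c 0 * x ^ 0) with 1 by (unfold hyp_coef; simpl; field).
  lra.
Qed.

(* Both sides solve the same hypergeometric equation.  Up to powers of [t] and
   [1 - t], [B] is their Wronskian, and [t^c B] is constant, hence zero. *)
Lemma euler_transformation a b (N : nat) x :
  let c := INR (S N) in
  0 < a -> 0 < b -> 0 < c - a -> 0 < c - b -> 0 <= x < 1 ->
  PSeries (hyp_coef a b c) x
  = Rpower (1 - x) (c - a - b) * PSeries (hyp_coef (c - a) (c - b) c) x.
Proof.
  intros c Ha Hb Ha' Hb' Hx.
  assert (Hc : 0 < c) by lra.
  set (s := c - a - b).
  set (h := hyp_coef a b c). set (g := hyp_coef (c - a) (c - b) c).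
  set (F := PSeries h). set (F1 := PSeries (PS_derive h)).
  set (F2 := PSeries (PS_derive (PS_derive h))).
  set (G := PSeries g). set (G1 := PSeries (PS_derive g)).
  set (G2 := PSeries (PS_derive (PS_derive g))).
  assert (Hh : CV_radius h = 1) by (apply CV_radius_hyp; assumption).
  assert (Hg : CV_radius g = 1) by (apply CV_radius_hyp; assumption).
  assert (HF : forall t, Rabs t < 1 -> is_derive F t (F1 t))
    by (intros; apply is_derive_PSeries; rewrite Hh; assumption).
  assert (HF1 : forall t, Rabs t < 1 -> is_derive F1 t (F2 t))
    by (intros; apply is_derive_PSeries; rewrite CV_radius_derive, Hh; assumption).
  assert (HG : forall t, Rabs t < 1 -> is_derive G t (G1 t))
    by (intros; apply is_derive_PSeries; rewrite Hg; assumption).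
  assert (HG1 : forall t, Rabs t < 1 -> is_derive G1 t (G2 t))
    by (intros; apply is_derive_PSeries; rewrite CV_radius_derive, Hg; assumption).
  set (B := fun t => (1 - t) * (F1 t * G t - F t * G1 t) + s * F t * G t).
  set (B1 := fun t => - (F1 t * G t - F t * G1 t)
    + (1 - t) * (F2 t * G t - F t * G2 t) + s * (F1 t * G t + F t * G1 t)).
  assert (HB1 : forall t, Rabs t < 1 -> is_derive B t (B1 t)).
  { intros t Ht. unfold B, B1.
    pose proof (HF t Ht). pose proof (HF1 t Ht).
    pose proof (HG t Ht). pose proof (HG1 t Ht).
    auto_derive; [repeat split; try (eexists; eassumption); exact I|].
    change (fun x => F x) with F. change (fun x => F1 x) with F1.
    change (fun x => G x) with G. change (fun x => G1 x) with G1.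
    rewrite (is_derive_unique F t _ H), (is_derive_unique F1 t _ H0),
      (is_derive_unique G t _ H1), (is_derive_unique G1 t _ H2). ring. }
  assert (Hode : forall t, Rabs t < 1 -> c * B t + t * B1 t = 0).
  { intros t Ht.
    pose proof (hyp_ode a b c t Ha Hb Hc Ht) as E1. simpl in E1.
    pose proof (hyp_ode (c - a) (c - b) c t Ha' Hb' Hc Ht) as E2. simpl in E2.
    change (t * (1 - t) * F2 t = a * b * F t - (c - (a + b + 1) * t) * F1 t) in E1.
    change (t * (1 - t) * G2 t = (c - a) * (c - b) * G t
      - (c - (c - a + (c - b) + 1) * t) * G1 t) in E2.
    unfold B, B1.
    transitivity (c * ((1 - t) * (F1 t * G t - F t * G1 t) + s * F t * G t)
      + (- t * (F1 t * G t - F t * G1 t)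
         + (t * (1 - t) * F2 t) * G t - F t * (t * (1 - t) * G2 t)
         + s * t * (F1 t * G t + F t * G1 t))); [ring|].
    rewrite E1, E2. unfold s. ring. }
  assert (HB0 : forall t, 0 <= t < 1 -> B t = 0).
  { intros t Ht. destruct (Req_dec t 0) as [->|Hne].
    - pose proof (Hode 0 ltac:(rewrite Rabs_R0; lra)) as E.
      rewrite Rmult_0_l, Rplus_0_r in E.
      apply Rmult_integral in E as [|]; [lra|assumption].
    (* As [c = S N] is a positive integer, [t^c] is differentiable at 0 as well and vanishes
       there. *)
    - assert (E : 0 ^ S N * B 0 = t ^ S N * B t).
      { apply (eq_is_derive (fun u => u ^ S N * B u)); [|lra].
        intros u Hu.
        assert (Hu1 : Rabs u < 1) by (rewrite Rabs_pos_eq; lra).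
        pose proof (HB1 u Hu1) as HBu.
        replace (@zero R_NormedModule) with (INR (S N) * 1 * u ^ N * B u + u ^ S N * B1 u).
        2:{ transitivity (u ^ N * (c * B u + u * B1 u)); [unfold c; simpl (u ^ S N); ring|].
            rewrite Hode by exact Hu1. apply Rmult_0_r. }
        apply (is_derive_mult (fun u => u ^ S N) B);
          [apply (is_derive_pow (fun u => u) (S N) u 1); apply (@is_derive_id R_AbsRing)
          | exact HBu | intros; apply Rmult_comm]. }
      rewrite pow_ne_zero, Rmult_0_l in E by lia.
      symmetry in E. apply Rmult_integral in E as [E|]; [|assumption].
      apply pow_nonzero in E; [destruct E | exact Hne]. }
  assert (HFp : forall t, 0 <= t < 1 -> 1 <= F t)
    by (intros; apply hyp_ge_1; assumption).
  assert (HGp : forall t, 0 <= t < 1 -> 1 <= G t)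
    by (intros; apply hyp_ge_1; assumption).
  (* The logarithm of the quotient of the two sides; its derivative is
     [B t / (F t * G t * (1 - t))]. *)
  set (W := fun t => ln (F t) - ln (G t) - s * ln (1 - t)).
  assert (HW : W 0 = W x).
  { destruct (Req_dec x 0) as [->|Hne]; [reflexivity|].
    apply (eq_is_derive W); [|lra].
    intros t Ht. pose proof (HFp t ltac:(lra)). pose proof (HGp t ltac:(lra)).
    assert (Ht1 : Rabs t < 1) by (rewrite Rabs_pos_eq; lra).
    pose proof (HF t Ht1) as H1. pose proof (HG t Ht1) as H2.
    unfold W. auto_derive; [repeat split; try (eexists; eassumption); lra|].
    change (fun x => F x) with F. change (fun x => G x) with G.
    rewrite (is_derive_unique F t _ H1), (is_derive_unique G t _ H2).
    change zero with 0.
    transitivity (B t / (F t * G t * (1 - t))); [unfold B; field; lra|].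
    rewrite HB0 by lra. unfold Rdiv. apply Rmult_0_l. }
  assert (HF0 : F 0 = 1) by (unfold F; rewrite PSeries_0; unfold h, hyp_coef; simpl; field).
  assert (HG0 : G 0 = 1) by (unfold G; rewrite PSeries_0; unfold g, hyp_coef; simpl; field).
  unfold W in HW. rewrite HF0, HG0, Rminus_0_r, ln_1 in HW.
  pose proof (HFp x Hx). pose proof (HGp x Hx).
  change (F x = Rpower (1 - x) s * G x). unfold Rpower.
  rewrite <- (exp_ln (F x)), <- (exp_ln (G x)), <- exp_plus by lra. f_equal. lra.
Qed.

(** Merges the half-parameters of a hypergeometric series in [1 / z ^ 2] into one factorial of the
    transformed Bessel series. *)
Lemma poch_double a n :
  poch (a / 2) n * poch ((a + 1) / 2) n = poch a (2 * n) / 4 ^ n.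
Proof.
  induction n as [|n IH]; [simpl; field|].
  replace (2 * S n)%nat with (S (S (2 * n))) by lia.
  cbn [poch pow]. rewrite S_INR, mult_INR. replace (INR 2) with 2 by (simpl; ring).
  transitivity (poch (a / 2) n * poch ((a + 1) / 2) n
                * ((a / 2 + INR n) * ((a + 1) / 2 + INR n))); [ring|].
  rewrite IH. field. apply pow_nonzero. lra.
Qed.

(* The Laplace transform at [z] of [I_N(t) t^(-P-1)], integrated termwise. *)
Definition bessel_laplace (N P : nat) (z : R) : R :=
  Series (fun j => INR (fact (2 * j + N - P - 1))
    / (2 ^ (2 * j + N) * INR (fact j) * INR (fact (N + j))) / z ^ (2 * j + N - P)).

Lemma bessel_laplace_hyp (N P : nat) z : (P < N)%nat -> 1 < z ->
  bessel_laplace N P z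
  = INR (fact (N - P - 1)) / (2 ^ N * INR (fact N) * z ^ (N - P))
    * PSeries (hyp_coef (INR (N - P) / 2) ((INR (N - P) + 1) / 2) (INR (S N)))
        (1 / z ^ 2).
Proof.
  intros HNP Hz. unfold bessel_laplace, PSeries. rewrite <- Series_scal_l.
  apply Series_ext. intros j. unfold hyp_coef. rewrite poch_double.
  replace (INR (N - P)) with (INR (N - P - 1) + 1)
    by (rewrite <- S_INR; f_equal; lia).
  rewrite S_INR, !poch_nat.
  replace (N - P - 1 + 2 * j)%nat with (2 * j + N - P - 1)%nat by lia.
  replace (2 * j + N - P)%nat with ((N - P) + 2 * j)%nat by lia.
  rewrite (Nat.add_comm (2 * j) N), !pow_add, !pow_mult.
  replace (2 ^ 2) with 4 by ring.
  unfold Rdiv at 8. rewrite Rmult_1_l, pow_inv.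
  field. repeat split; try apply INR_fact_neq_0;
    repeat apply pow_nonzero; lra.
Qed.

(** Euler's transformation with [c = N + 1] turns the parameters of [legendreQ] into those of
    [bessel_laplace_hyp]. Its exponent is [c - a - b = - mu] with [mu = P + 1/2], so the power
    [mu / 2] of [z^2 - 1] in [legendreQ] becomes [- mu / 2]. *)
Lemma legendreQ_laplace (N P : nat) z : (P < N)%nat -> 1 < z ->
  legendreQ (INR N - 1 / 2) (INR P + 1 / 2) z
  = (cis (PI * (INR P + 1 / 2))
     * RtoC (sqrt (PI / 2) * (INR (fact (N + P)) / INR (fact (N - P - 1)))
             * Rpower (z ^ 2 - 1) (- ((INR P + 1 / 2) / 2))
             * bessel_laplace N P z))%C.
Proof.
  intros HNP Hz. unfold legendreQ. f_equal. f_equal.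
  rewrite bessel_laplace_hyp by assumption.
  assert (Hz2 : 1 < z ^ 2) by (simpl; nra).
  replace (INR N - 1 / 2 + (INR P + 1 / 2) + 1) with (INR (N + P) + 1)
    by (rewrite plus_INR; field).
  replace (INR N - 1 / 2 + 3 / 2) with (INR N + 1) by field.
  replace (INR N - 1 / 2 + 1) with (INR N + / 2) by field.
  rewrite !Gamma_nat.
  replace (INR (N + P) + 1) with (INR (S (N + P))) at 1 by apply S_INR.
  rewrite (Rpower_plus (INR N)), Rpower_sqrt, !Rpower_pow by lra.
  change (hyp2F1 ?a ?b ?c ?x) with (PSeries (hyp_coef a b c) x).
  replace (INR N + 1) with (INR (S N)) by apply S_INR.
  assert (Hsub : INR (N - P) = INR N - INR P) by (apply minus_INR; lia).
  assert (Hlt : 0 < INR (N - P)) by (apply lt_0_INR; lia).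
  pose proof (pos_INR N). pose proof (pos_INR P).
  assert (Hinv : 0 < 1 / z ^ 2 < 1).
  { split; [apply Rdiv_lt_0_compat; lra|].
    apply (Rmult_lt_reg_r (z ^ 2)); [lra|]. unfold Rdiv.
    rewrite Rmult_assoc, Rinv_l; lra. }
  rewrite euler_transformation; rewrite ?S_INR, ?plus_INR; try lra.
  replace (INR N + 1 - (INR N + INR P + 1 + 1) / 2) with (INR (N - P) / 2)
    by (rewrite Hsub; field).
  replace (INR N + 1 - (INR N + INR P + 1) / 2) with ((INR (N - P) + 1) / 2)
    by (rewrite Hsub; field).
  replace (INR N + 1 - (INR N - 1 / 2 + (INR P + 1 / 2) + 2) / 2)
    with (INR (N - P) / 2) by (rewrite Hsub; field).
  rewrite hyp_coef_sym.
  set (mu := INR P + 1 / 2). set (F := PSeries _ _).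
  replace ((INR (N - P) + 1) / 2 - (INR N - 1 / 2 + mu + 2) / 2) with (- mu)
    by (rewrite Hsub; unfold mu; field).
  assert (HR : Rpower (1 - 1 / z ^ 2) (- mu)
               = Rpower (z ^ 2 - 1) (- mu) * z ^ (2 * P + 1)).
  { replace (1 - 1 / z ^ 2) with ((z ^ 2 - 1) * / z ^ 2) by (field; lra).
    rewrite <- Rpower_mult_distr by (try apply Rinv_0_lt_compat; lra).
    f_equal. rewrite <- (Rpower_pow (2 * P + 1)) by lra. unfold Rpower.
    rewrite ln_Rinv, ln_pow, plus_INR, mult_INR by lra.
    f_equal. unfold mu. simpl. field. }
  rewrite HR. replace (- mu) with (- (mu / 2) + - (mu / 2)) by field.
  rewrite Rpower_plus, Rpower_Ropp.
  pose proof (exp_pos (mu / 2 * ln (z ^ 2 - 1))) as Hpos.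
  change (0 < Rpower (z ^ 2 - 1) (mu / 2)) in Hpos.
  rewrite sqrt_div_alt by lra.
  replace (S (N + P)) with ((N - P) + (2 * P + 1))%nat by lia. rewrite pow_add.
  pose proof (sqrt_lt_R0 2 ltac:(lra)).
  field. repeat split; try apply INR_fact_neq_0; try (apply pow_nonzero; lra); lra.
Qed.

(** * The termwise Laplace transform *)

Lemma sum_f_R0_diff_le (f : nat -> R) m n : (m <= n)%nat ->
  Rabs (sum_f_R0 f n - sum_f_R0 f m) <= sum_f_R0 (fun i => Rabs (f i)) n.
Proof.
  induction 1 as [|n Hmn IH].
  - rewrite Rminus_diag, Rabs_R0. apply cond_pos_sum. intros; apply Rabs_pos.
  - rewrite !tech5.
    replace (_ + _ - _) with ((sum_f_R0 f n - sum_f_R0 f m) + f (S n)) by ring.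
    eapply Rle_trans; [apply Rabs_triang|]. lra.
Qed.

Lemma sum_f_R0_term_le (f : nat -> R) i n : (i <= n)%nat ->
  Rabs (f i) <= sum_f_R0 (fun i => Rabs (f i)) n.
Proof.
  induction 1 as [|n Hin IH].
  - destruct i as [|i]; [apply Rle_refl|]. rewrite tech5.
    pose proof (cond_pos_sum (fun i => Rabs (f i)) i (fun n => Rabs_pos _)). lra.
  - rewrite tech5. pose proof (Rabs_pos (f (S n))). lra.
Qed.

Lemma Series_sum_f_R0 (a : nat -> nat -> R) N :
  (forall n, ex_series (a n)) ->
  Series (fun k => sum_f_R0 (fun n => a n k) N) = sum_f_R0 (fun n => Series (a n)) N
  /\ ex_series (fun k => sum_f_R0 (fun n => a n k) N).
Proof.
  intros Ha. induction N as [|N [IH1 IH2]]; [split; [reflexivity | apply (Ha 0%nat)]|].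
  simpl. split.
  - rewrite Series_plus by (try exact IH2; apply Ha). rewrite IH1. reflexivity.
  - apply (ex_series_plus (fun k => sum_f_R0 (fun n => a n k) N) (a (S N)));
      [exact IH2 | apply Ha].
Qed.

Lemma ex_series_dominated (a b : nat -> R) :
  (forall n, Rabs (a n) <= b n) -> ex_series b -> ex_series a.
Proof. exact (@ex_series_le R_AbsRing R_CompleteNormedModule a b). Qed.

Lemma Series_tail_le (b M : nat -> R) N :
  ex_series M -> (forall k, Rabs (b k) <= M k) ->
  (forall k, (k <= N)%nat -> b k = 0) ->
  Rabs (Series b) <= Series M - sum_f_R0 M N.
Proof.
  intros HM Hb Hz.
  assert (Hex : ex_series (fun k => Rabs (b k))).
  { apply (ex_series_dominated _ M); [|exact HM].
    intros n. rewrite Rabs_Rabsolu. apply Hb. }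
  pose proof (ex_series_Rabs _ Hex) as Hexb.
  rewrite (Series_incr_n b (S N)), (Series_incr_n M (S N)) by (try lia; assumption).
  simpl pred. rewrite (sum_f_R0_zero b) by exact Hz. rewrite Rplus_0_l.
  assert (HMs : ex_series (fun k => M (S N + k)%nat))
    by (apply (ex_series_incr_n M); exact HM).
  eapply Rle_trans; [apply Series_Rabs|].
  - apply (ex_series_incr_n (fun k => Rabs (b k))), Hex.
  - eapply Rle_trans; [apply Series_le; [|exact HMs]|].
    + intros n. split; [apply Rabs_pos | apply Hb].
    + lra.
Qed.

(** The first [N] rows already contain every nonzero term of the columns [k <= N], so their sum
    differs from the limit by at most the tail of [M]. *)
Lemma is_series_triangular (a : nat -> nat -> R) (M : nat -> R) :
  (forall n k, (k < n)%nat -> a n k = 0) -> ex_series M ->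
  (forall k, sum_f_R0 (fun n => Rabs (a n k)) k <= M k) ->
  is_series (fun n => Series (a n)) (Series (fun k => sum_f_R0 (fun n => a n k) k)).
Proof.
  intros Htri HM Hle.
  assert (Hterm : forall n k, Rabs (a n k) <= M k).
  { intros n k. destruct (le_lt_dec n k) as [Hnk|Hkn].
    - eapply Rle_trans; [apply (sum_f_R0_term_le (fun n => a n k) n k Hnk) | apply Hle].
    - rewrite Htri, Rabs_R0 by exact Hkn.
      eapply Rle_trans; [|apply Hle]. apply cond_pos_sum. intros; apply Rabs_pos. }
  assert (Hex : forall n, ex_series (a n))
    by (intros n; apply (ex_series_dominated _ M); [intros k; apply Hterm | exact HM]).
  assert (Hdiag : ex_series (fun k => sum_f_R0 (fun n => a n k) k)).
  { apply (ex_series_dominated _ M); [|exact HM]. intros k.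
    eapply Rle_trans; [apply sum_f_R0_triangle | apply Hle]. }
  set (l := Series _).
  set (r := fun N => Series M - sum_f_R0 M N).
  assert (Hr : is_lim_seq r 0).
  { replace (Finite 0) with (Finite (Series M - Series M)) by (f_equal; ring).
    apply is_lim_seq_minus'; [apply is_lim_seq_const|].
    apply (is_lim_seq_ext (sum_n M)); [intros; apply sum_n_Reals|].
    apply Series_correct, HM. }
  change (is_lim_seq (sum_n (fun n => Series (a n))) l).
  apply (is_lim_seq_le_le (fun N => l - r N) _ (fun N => l + r N)).
  - intros N. rewrite sum_n_Reals.
    destruct (Series_sum_f_R0 a N Hex) as [E HexN]. rewrite <- E.
    enough (H : Rabs (l - Series (fun k => sum_f_R0 (fun n => a n k) N)) <= r N)
      by (apply Rabs_le_between in H; lra).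
    unfold l. rewrite <- Series_minus by assumption.
    apply Series_tail_le; [exact HM| |].
    + intros k. destruct (le_lt_dec N k).
      * eapply Rle_trans; [apply sum_f_R0_diff_le; assumption | apply Hle].
      * rewrite (sum_f_R0_trunc _ k N), Rminus_diag, Rabs_R0; [| lia | intros; apply Htri; lia].
        eapply Rle_trans; [apply Rabs_pos | apply (Hterm 0%nat)].
    + intros k Hk. rewrite (sum_f_R0_trunc _ k N); [ring | exact Hk | intros; apply Htri; lia].
  - replace (Finite l) with (Finite (l - 0)) by (f_equal; ring).
    apply is_lim_seq_minus'; [apply is_lim_seq_const | exact Hr].
  - replace (Finite l) with (Finite (l + 0)) by (f_equal; ring).
    apply is_lim_seq_plus'; [apply is_lim_seq_const | exact Hr].
Qed.

(* If [f] vanishes up to order [p], this is [A^p] times the integral of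
   [exp (- A z) z^(-p-1) sum_k f_k z^k] over the half line. *)
Definition laplace_weight (A : R) (p k : nat) : R :=
  INR (fact (k - p - 1)) * A ^ p / A ^ k.

Definition laplace (A : R) (p : nat) (f : nat -> R) : R :=
  Series (fun k => f k * laplace_weight A p k).

Lemma laplace_weight_pos A p k : 0 < A -> 0 < laplace_weight A p k.
Proof.
  intros HA. apply Rdiv_lt_0_compat;
    [apply Rmult_lt_0_compat; [apply INR_fact_pos|]|]; apply pow_lt; exact HA.
Qed.

(** The factorial of the weight is at most the one in [exp_coef], which leaves a geometric series of
    ratio [b / A]. *)
Lemma ex_series_exp_laplace A p b : 0 <= b < A ->
  ex_series (fun k => exp_coef b k * laplace_weight A p k).
Proof.
  intros Hb.
  apply (ex_series_dominated _ (fun k => A ^ p * (b / A) ^ k)).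
  - intros k.
    pose proof (laplace_weight_pos A p k ltac:(lra)) as Hw.
    rewrite Rabs_pos_eq by (apply Rmult_le_pos; [apply exp_coef_pos|]; lra).
    unfold exp_coef, laplace_weight, Rdiv. rewrite Rpow_mult_distr, pow_inv.
    assert (Hf : / INR (fact k) * INR (fact (k - p - 1)) <= 1).
    { apply (Rmult_le_reg_l (INR (fact k))); [apply INR_fact_pos|].
      rewrite <- Rmult_assoc, Rinv_r, Rmult_1_l, Rmult_1_r by apply INR_fact_neq_0.
      apply le_INR, fact_le. lia. }
    assert (Hp : 0 <= A ^ p * (b ^ k * / A ^ k)).
    { apply Rmult_le_pos; [apply pow_le; lra|].
      apply Rmult_le_pos; [apply pow_le; lra|].
      left. apply Rinv_0_lt_compat, pow_lt. lra. }
    nra.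
  - apply (ex_series_scal_l (A ^ p) (fun k => (b / A) ^ k)), ex_series_geom.
    rewrite Rabs_pos_eq by (apply Rdiv_le_0_compat; lra).
    apply (Rmult_lt_reg_r A); [lra|]. unfold Rdiv. rewrite Rmult_assoc, Rinv_l; lra.
Qed.

Lemma ex_series_laplace A p b f : 0 <= b < A -> exp_bounded b f ->
  ex_series (fun k => f k * laplace_weight A p k).
Proof.
  intros Hb Hf. eapply (ex_series_dominated _ _); [|apply (ex_series_exp_laplace A p b Hb)].
  intros k.
  pose proof (laplace_weight_pos A p k ltac:(lra)).
  rewrite Rabs_mult, (Rabs_pos_eq (laplace_weight A p k)) by lra.
  apply Rmult_le_compat_r; [lra | apply Hf].
Qed.

(** The exchange of sum and transform behind both the Jacobi and the cosine sums. Since [g n] starts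
    in degree [n], the expansion of [f] is finite in each coefficient; [rest] is the part of the
    frontier that the sum does not touch. *)
Lemma laplace_sum A p a b (c : nat -> R) (g : nat -> nat -> R) (f rest : nat -> R) :
  0 <= a -> 0 <= b -> a + b < A ->
  (forall n k, (k < n)%nat -> g n k = 0) ->
  (forall k, sum_f_R0 (fun n => c n * g n k) k = f k) ->
  (forall k, sum_f_R0 (fun n => Rabs (c n) * Rabs (g n k)) k <= exp_coef a k) ->
  exp_bounded b rest ->
  is_series (fun n => c n * laplace A p (PS_mult (g n) rest))
            (laplace A p (PS_mult f rest)).
Proof.
  intros Ha Hb HA Hlow Hsum Habs Hrest.
  set (h := fun n k => c n * PS_mult (g n) rest k * laplace_weight A p k).
  assert (Hh0 : forall n k, (k < n)%nat -> PS_mult (g n) rest k = 0).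
  { intros n k Hk. unfold PS_mult. apply sum_f_R0_zero.
    intros i Hi. rewrite Hlow by lia. ring. }
  apply (is_series_ext (fun n => Series (h n))).
  { intros n. unfold laplace. rewrite <- Series_scal_l.
    apply Series_ext. intros; unfold h; ring. }
  replace (laplace A p (PS_mult f rest))
    with (Series (fun k => sum_f_R0 (fun n => h n k) k)).
  - apply (is_series_triangular h (fun k => exp_coef (a + b) k * laplace_weight A p k)).
    + intros n k Hk. unfold h. rewrite Hh0 by exact Hk. ring.
    + apply ex_series_exp_laplace. lra.
    + intros k. unfold h.
      pose proof (laplace_weight_pos A p k ltac:(lra)).
      rewrite (sum_eq _ (fun n => laplace_weight A p k * Rabs (c n * PS_mult (g n) rest k))).
      2:{ intros n _. rewrite Rabs_mult, (Rabs_pos_eq (laplace_weight A p k)) by lra. ring. }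
      rewrite sum_f_R0_scal, Rmult_comm. apply Rmult_le_compat_r; [lra|].
      rewrite <- exp_coef_plus.
      apply Rle_trans with (sum_f_R0 (fun n => sum_f_R0 (fun i =>
        Rabs (c n) * Rabs (g n i) * Rabs (rest (k - i)%nat)) k) k).
      * apply sum_Rle. intros n _. unfold PS_mult.
        rewrite <- sum_f_R0_scal. eapply Rle_trans; [apply sum_f_R0_triangle|].
        right. apply sum_eq. intros i _. rewrite !Rabs_mult. ring.
      * rewrite sum_f_R0_swap. unfold PS_mult. apply sum_Rle. intros i Hi.
        rewrite (sum_eq _ (fun n => Rabs (rest (k - i)%nat) * (Rabs (c n) * Rabs (g n i))))
          by (intros; ring).
        rewrite sum_f_R0_scal, Rmult_comm. apply Rmult_le_compat.
        -- apply cond_pos_sum. intros n. apply Rmult_le_pos; apply Rabs_pos.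
        -- apply Rabs_pos.
        -- rewrite (sum_f_R0_trunc _ i k); [apply Habs | exact Hi |].
           intros n Hn. rewrite (Hlow n i), Rabs_R0 by exact Hn. ring.
        -- apply Hrest.
  - apply Series_ext. intros k. unfold h.
    rewrite (sum_eq _ (fun n => laplace_weight A p k * (c n * PS_mult (g n) rest k)))
      by (intros; ring).
    rewrite sum_f_R0_scal, Rmult_comm. f_equal.
    unfold PS_mult.
    rewrite (sum_eq _ (fun n => sum_f_R0 (fun i => c n * g n i * rest (k - i)%nat) k)).
    2:{ intros n _. rewrite <- sum_f_R0_scal. apply sum_eq. intros; ring. }
    rewrite sum_f_R0_swap. apply sum_eq. intros i Hi.
    rewrite (sum_eq _ (fun n => rest (k - i)%nat * (c n * g n i))) by (intros; ring).
    rewrite sum_f_R0_scal, Rmult_comm. f_equal.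
    rewrite <- Hsum. apply sum_f_R0_trunc; [exact Hi|].
    intros n Hn. rewrite Hlow by exact Hn. ring.
Qed.

(** Series lemmas leave equations over the carrier of a module; [ring] and [field] need it displayed
    as [R]. *)
Ltac real_eq := match goal with |- @eq _ ?a ?b => change (@eq R a b) end.

(** Multiplying the series for [S N] by [1 - y], that is, subtracting its shift, gives [N + 1] times
    the series for [N]. *)
Lemma negative_binomial N y : Rabs y < 1 ->
  is_series (fun j => INR (fact (N + j)) / INR (fact j) * y ^ j)
            (INR (fact N) / (1 - y) ^ S N).
Proof.
  intros Hy. induction N as [|N IH].
  - apply (is_series_ext (fun j => y ^ j)).
    { intros j. simpl. field. apply INR_fact_neq_0. }
    replace (_ / _) with (/ (1 - y))
      by (simpl; field; apply Rabs_def2 in Hy; lra).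
    apply is_series_geom, Hy.
  - set (u := fun j => INR (fact (S N + j)) / INR (fact j)).
    assert (Hex : ex_series (fun j => u j * y ^ j)).
    { apply (ex_series_ext (fun j => INR (fact (S N)) *
        (hyp_coef (INR (S N) + 1) 1 1 j * y ^ j))).
      - intros j. unfold u, hyp_coef. rewrite poch_nat.
        pose proof (poch_pos 1 j ltac:(lra)).
        real_eq. field. repeat split; try apply INR_fact_neq_0; lra.
      - apply (ex_series_scal_l (INR (fact (S N)))
          (fun j => hyp_coef (INR (S N) + 1) 1 1 j * y ^ j)).
        apply ex_series_Rabs, CV_disk_inside.
        rewrite CV_radius_hyp; try lra; [exact Hy|].
        pose proof (pos_INR (S N)). lra. }
    apply Series_correct in Hex. set (l := Series _) in Hex.
    assert (Hshift := is_pseries_incr_1 u y l (proj2 (is_pseries_R _ _ _) Hex)).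
    rewrite is_pseries_R in Hshift.
    pose proof (is_series_minus _ _ _ _ Hex Hshift) as Hd.
    apply (is_series_scal (INR N + 1)) in IH.
    apply is_series_unique in IH, Hd.
    rewrite (Series_ext _ (fun n => scal (INR N + 1)
      (INR (fact (N + n)) / INR (fact n) * y ^ n))) in Hd.
    2:{ intros [|j]; unfold PS_incr_1, u, plus, opp, scal, zero; simpl plus; simpl opp.
        - unfold mult. cbn -[fact INR]. rewrite !Nat.add_0_r, fact_S. cbn [pow]. field.
          apply INR_fact_neq_0.
        - unfold mult. cbn -[fact INR pow].
          replace (S (N + S j)) with (S (S (N + j))) by lia.
          replace (N + S j)%nat with (S (N + j)) by lia.
          rewrite !fact_S, !S_INR, plus_INR. cbn [pow].
          pose proof (pos_INR j).
          field. repeat split; try apply INR_fact_neq_0; lra. }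
    pose proof (eq_trans (eq_sym IH) Hd) as E.
    change ((INR N + 1) * (INR (fact N) / (1 - y) ^ S N) = l + - (y * l)) in E.
    replace (_ / _) with l; [exact Hex|].
    apply Rabs_def2 in Hy.
    apply (Rmult_eq_reg_l (1 - y)); [|lra].
    transitivity (l + - (y * l)); [ring|]. rewrite <- E, fact_S. simpl pow.
    field. split; [apply pow_nonzero|]; lra.
Qed.

Lemma sum_f_R0_pick (u : nat -> R) n k : (n <= k)%nat ->
  sum_f_R0 (fun i => u i * (if (i =? n)%nat then 1 else 0)) k = u n.
Proof.
  intros Hnk. rewrite (sum_f_R0_trunc _ n k Hnk).
  2:{ intros i Hi. destruct (Nat.eqb_spec i n); [lia|ring]. }
  destruct n as [|n]; [simpl; ring|].
  rewrite tech5, Nat.eqb_refl, sum_f_R0_zero; [ring|].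
  intros i Hi. destruct (Nat.eqb_spec i (S n)); [lia|ring].
Qed.

(** A factor [exp (s z)] moves the argument of the transform. For a monomial this is the negative
    binomial series in [s / A]; [laplace_sum] extends it to [f]. *)
Lemma laplace_shift A p a s f :
  0 <= a -> a + Rabs s < A -> exp_bounded a f ->
  (forall k, (k <= p)%nat -> f k = 0) ->
  laplace A p (PS_mult f (exp_coef s)) = laplace (A - s) p f.
Proof.
  intros Ha HA Hf Hlow. pose proof (Rabs_pos s) as Hs0.
  assert (HsA : 0 < A - s) by (pose proof (Rle_abs s); lra).
  (* [g n] is the monomial [z^n], and [f] is expanded with its own coefficients. *)
  set (g := fun n k => if (k =? n)%nat then 1 else 0).
  assert (Hpick : forall (u : nat -> R) k,
    sum_f_R0 (fun n => u n * g n k) k = u k).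
  { intros u k. rewrite <- (sum_f_R0_pick u k k) by lia.
    apply sum_eq. intros i _. unfold g. rewrite Nat.eqb_sym. reflexivity. }
  symmetry. apply is_series_unique.
  apply (is_series_ext (fun n => f n * laplace A p (PS_mult (g n) (exp_coef s)))).
  2:{ apply (laplace_sum A p a (Rabs s) f g f); try assumption.
      - intros n k Hk. unfold g. destruct (Nat.eqb_spec k n); [lia|reflexivity].
      - apply Hpick.
      - intros k. eapply Rle_trans; [right | apply Hf]. rewrite <- (Hpick (fun n => Rabs (f n)) k).
        apply sum_eq. intros n _. unfold g.
        destruct (k =? n)%nat; [rewrite Rabs_R1 | rewrite Rabs_R0]; reflexivity.
      - apply exp_bounded_exp, Rle_refl. }
  (* Up to degree [p] the subtraction in [laplace_weight] truncates and its value means nothing, but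
     [f n] is zero there. *)
  intros n. destruct (le_lt_dec n p) as [Hn|Hn]; [rewrite Hlow by exact Hn; real_eq; ring|].
  f_equal. unfold laplace.
  assert (Hg : forall k, PS_mult (g n) (exp_coef s) k
    = if (n <=? k)%nat then exp_coef s (k - n) else 0).
  { intros k. unfold PS_mult, g.
    rewrite (sum_eq _ (fun i => exp_coef s (k - i) * (if (i =? n)%nat then 1 else 0)))
      by (intros; ring).
    destruct (Nat.leb_spec n k) as [Hnk|Hnk].
    - apply (sum_f_R0_pick (fun i => exp_coef s (k - i)) n k Hnk).
    - apply sum_f_R0_zero. intros i Hi. destruct (Nat.eqb_spec i n); [lia|ring]. }
  set (N := (n - p - 1)%nat).
  assert (HsA1 : Rabs (s / A) < 1).
  { unfold Rdiv. rewrite Rabs_mult, (Rabs_pos_eq (/ A)).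
    - apply (Rmult_lt_reg_r A); [lra|]. rewrite Rmult_assoc, Rinv_l; lra.
    - left. apply Rinv_0_lt_compat. lra. }
  assert (Htail : is_series (fun j => PS_mult (g n) (exp_coef s) (n + j)
      * laplace_weight A p (n + j)) (laplace_weight (A - s) p n)).
  { apply (is_series_ext (fun j => scal (A ^ p / A ^ n)
      (INR (fact (N + j)) / INR (fact j) * (s / A) ^ j))).
    - intros j. unfold scal. simpl. unfold mult. simpl.
      rewrite Hg, (proj2 (Nat.leb_le n (n + j))) by lia.
      replace (n + j - n)%nat with j by lia. unfold exp_coef, laplace_weight.
      replace (n + j - p - 1)%nat with (N + j)%nat by (unfold N; lia).
      unfold Rdiv. rewrite Rpow_mult_distr, pow_inv, pow_add.
      field. repeat split; try apply INR_fact_neq_0; apply pow_nonzero; lra.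
    - replace (laplace_weight (A - s) p n)
        with (scal (A ^ p / A ^ n) (INR (fact N) / (1 - s / A) ^ S N)).
      + apply (@is_series_scal R_AbsRing R_NormedModule), negative_binomial, HsA1.
      + unfold scal. simpl scal. unfold mult. cbn -[fact INR pow Rdiv].
        unfold laplace_weight. fold N.
        replace (1 - s / A) with ((A - s) * / A) by (field; lra).
        rewrite Rpow_mult_distr, pow_inv.
        replace n with (p + S N)%nat by (unfold N; lia). rewrite !pow_add.
        field. repeat split; apply pow_nonzero; lra. }
  assert (Hex : ex_series (fun k => PS_mult (g n) (exp_coef s) k * laplace_weight A p k))
    by (apply (ex_series_incr_n _ n); eexists; exact Htail).
  rewrite (Series_incr_n _ n) by (lia || exact Hex).
  rewrite (is_series_unique _ _ Htail), sum_f_R0_zero; [apply Rplus_0_l|].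
  intros i Hi. rewrite Hg, (proj2 (Nat.leb_gt n i)) by lia. ring.
Qed.

Lemma Series_spread l (B w : nat -> R) :
  ex_series (fun k => spread l B k * w k) ->
  Series (fun k => spread l B k * w k) = Series (fun j => B j * w (l + 2 * j)%nat).
Proof.
  intros Hex. symmetry. apply is_series_unique.
  apply Series_correct in Hex. set (v := Series _) in *.
  change (is_lim_seq (sum_n (fun k => spread l B k * w k)) v) in Hex.
  change (is_lim_seq (sum_n (fun j => B j * w (l + 2 * j)%nat)) v).
  apply (is_lim_seq_subseq _ _ (fun j => l + 2 * j)%nat) in Hex.
  2:{ apply eventually_subseq. intros; lia. }
  eapply is_lim_seq_ext; [|exact Hex]. intros J. cbv beta. rewrite !sum_n_Reals.
  induction J as [|J IH].
  - rewrite Nat.mul_0_r, Nat.add_0_r.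
    assert (Hz : forall i, (i < l)%nat -> spread l B i * w i = 0)
      by (intros; rewrite spread_off by lia; ring).
    destruct l as [|l]; [reflexivity|]. rewrite tech5, sum_f_R0_zero.
    + pose proof (spread_at (S l) B 0) as E. rewrite Nat.mul_0_r, Nat.add_0_r in E.
      rewrite E. simpl. rewrite Nat.add_0_r. ring.
    + intros i Hi. apply Hz. lia.
  - replace (l + 2 * S J)%nat with (S (S (l + 2 * J))) by lia.
    rewrite !tech5, IH.
    rewrite (spread_off l B (S (l + 2 * J))) by lia.
    replace (S (S (l + 2 * J))) with (l + 2 * S J)%nat by lia.
    rewrite spread_at. ring.
Qed.

(** Under the substitution [t = a z] the division by [(a z)^h] becomes a shift of [p] by [h]. *)
Lemma laplace_bessel A p h l a : (p < l)%nat -> 0 < a < A ->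
  laplace A p (bessel_coef h l a) = a ^ p * bessel_laplace (l + h) (p + h) (A / a).
Proof.
  intros Hpl Ha. unfold laplace, bessel_coef. rewrite Series_spread.
  2:{ apply (ex_series_laplace A p a (bessel_coef h l a));
      [lra | apply exp_bounded_bessel; lra]. }
  unfold bessel_laplace. rewrite <- Series_scal_l. apply Series_ext. intros j.
  unfold laplace_weight.
  replace (2 * j + (l + h) - (p + h))%nat with (l + 2 * j - p)%nat by lia.
  replace (2 * j + (l + h))%nat with (l + 2 * j + h)%nat by lia.
  replace (l + h + j)%nat with (l + j + h)%nat by lia.
  set (r := (l + 2 * j - p)%nat).
  replace (l + 2 * j)%nat with (p + r)%nat by (unfold r; lia).
  replace ((A / a) ^ r) with (A ^ r / a ^ r)
    by (unfold Rdiv; rewrite Rpow_mult_distr, pow_inv; reflexivity).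
  rewrite !pow_add.
  field. repeat split; try apply INR_fact_neq_0; apply pow_nonzero; lra.
Qed.

(** * Complex series *)

Lemma sum_n_RtoC_mult (a : nat -> R) (K : C) n :
  sum_n (fun i => (RtoC (a i) * K)%C) n = (RtoC (sum_n a n) * K)%C.
Proof.
  induction n as [|n IH]; [rewrite !sum_O; reflexivity|].
  rewrite !sum_Sn, IH. change plus with Cplus at 1. unfold plus. simpl.
  rewrite RtoC_plus. ring.
Qed.

Lemma is_series_RtoC_mult (a : nat -> R) (l : R) (K : C) :
  is_series a l -> is_series (fun i => (RtoC (a i) * K)%C) (RtoC l * K)%C.
Proof.
  intros Ha. change (is_lim_seq (sum_n a) l) in Ha.
  apply filterlim_locally. intros eps.
  assert (Hc : forall k : R, eventually (fun n => Rabs (sum_n a n * k - l * k) < eps)).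
  { intros k.
    pose proof (is_lim_seq_scal_r _ k _ Ha) as H.
    apply is_lim_seq_spec in H. exact (H eps). }
  destruct (Hc (fst K)) as [n1 H1]. destruct (Hc (snd K)) as [n2 H2].
  exists (max n1 n2). intros n Hn. rewrite sum_n_RtoC_mult.
  split; unfold ball; simpl; unfold AbsRing_ball, abs, minus, plus, opp; simpl.
  - rewrite !Rmult_0_l, !Rminus_0_r. apply H1. lia.
  - rewrite !Rmult_0_l, !Rplus_0_r. apply H2. lia.
Qed.

(** All summands are real multiples of one complex constant, so the analysis stays real. *)
Lemma is_weighted_sum_RtoC (w t : nat -> R) inner (l : R) (K : C) :
  (forall n, inner n (RtoC (t n) * K)%C) -> is_series (fun n => w n * t n) l ->
  is_weighted_sum w inner (RtoC l * K)%C.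
Proof.
  intros Hin Hs. exists (fun n => (RtoC (t n) * K)%C). split; [exact Hin|].
  eapply is_series_ext; [|apply (is_series_RtoC_mult _ _ K Hs)].
  intros n. cbv beta. rewrite RtoC_mult. symmetry. apply Cmult_assoc.
Qed.

(** * The factorization at a node *)

Lemma Series_finite (a : nat -> R) n :
  (forall k, (n < k)%nat -> a k = 0) -> Series a = sum_f_R0 a n.
Proof.
  intros Ha. apply is_series_unique.
  change (is_lim_seq (sum_n a) (sum_f_R0 a n)).
  apply (is_lim_seq_ext_loc (fun _ => sum_f_R0 a n)); [|apply is_lim_seq_const].
  exists n. intros N HN. rewrite sum_n_Reals. symmetry. apply sum_f_R0_trunc; assumption.
Qed.

Lemma jacobi_jval al be n t :
  jacobi n (INR be) (INR al) (cos (2 * t))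
  = jval (INR al + INR be + 1) (INR be) n (sin t ^ 2).
Proof.
  unfold jacobi, hyp2F1.
  replace ((1 - cos (2 * t)) / 2) with (sin t ^ 2) by (rewrite cos_2a_sin; field).
  replace (INR n + INR be + INR al + 1) with (INR n + (INR al + INR be + 1)) by ring.
  rewrite (Series_finite _ n).
  - unfold jval. rewrite <- sum_f_R0_scal. apply sum_eq. intros. unfold jcoef. ring.
  - intros k Hk. rewrite poch_opp_zero by exact Hk. unfold Rdiv. ring.
Qed.

Definition jacobi_mode (h l m n : nat) (t : R) : R :=
  sqrt (jnorm (l + h) (m + h) n) * cos t ^ l * sin t ^ m
  * jval (INR (l + h) + INR (m + h) + 1) (INR (m + h)) n (sin t ^ 2).

Lemma jacobi_mode_product h l m a t t' k :
  sum_f_R0 (fun n => 2 * (jacobi_mode h l m n t * jacobi_mode h l m n t')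
                     * bessel_coef (2 * h + 1) (2 * n + l + m) a k) k
  = PS_mult (bessel_coef h l (a * (cos t * cos t')))
            (bessel_coef h m (a * (sin t * sin t'))) k.
Proof.
  rewrite (bessel_coef_product h l m k a _ _ (sin t ^ 2) (sin t' ^ 2)).
  - rewrite <- sum_f_R0_scal. apply sum_eq. intros n _. unfold jacobi_mode.
    set (J := jnorm (l + h) (m + h) n).
    assert (HJ : sqrt J * sqrt J = J).
    { apply sqrt_sqrt. unfold J, jnorm. apply Rdiv_le_0_compat.
      - repeat apply Rmult_le_pos; apply pos_INR.
      - apply Rmult_lt_0_compat; apply INR_fact_pos. }
    rewrite <- HJ at 3. rewrite !Rpow_mult_distr. ring.
  - rewrite Rpow_mult_distr, <- !Rsqr_pow2, !cos2. reflexivity.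
  - apply Rpow_mult_distr.
Qed.

(** For equal angles the two factors have rates [a cos^2] and [a sin^2], which add up to [a]. *)
Lemma jacobi_mode_diag_le h l m a t k : 0 <= a ->
  sum_f_R0 (fun n => 2 * (jacobi_mode h l m n t * jacobi_mode h l m n t)
                     * bessel_coef (2 * h + 1) (2 * n + l + m) a k) k
  <= exp_coef a k.
Proof.
  intros Ha. rewrite jacobi_mode_product.
  eapply Rle_trans; [apply Rle_abs|].
  replace a with (a * (cos t * cos t) + a * (sin t * sin t)) at 3.
  - pose proof (Rle_0_sqr (cos t)). pose proof (Rle_0_sqr (sin t)). unfold Rsqr in *.
    apply exp_bounded_mult; apply exp_bounded_bessel; apply Rmult_le_pos; assumption.
  - pose proof (sin2_cos2 t) as E. unfold Rsqr in E.
    rewrite <- Rmult_plus_distr_l, Rplus_comm, E. ring.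
Qed.

(* AM-GM reduces this to the diagonal [t = t'], where the terms are nonnegative
   and [jacobi_mode_product] evaluates their sum. *)
Lemma jacobi_mode_abs_le h l m a t t' k : 0 <= a ->
  sum_f_R0 (fun n => Rabs (2 * (jacobi_mode h l m n t * jacobi_mode h l m n t'))
                     * Rabs (bessel_coef (2 * h + 1) (2 * n + l + m) a k)) k
  <= exp_coef a k.
Proof.
  intros Ha.
  apply Rle_trans with (/ 2 * exp_coef a k + / 2 * exp_coef a k); [|lra].
  eapply Rle_trans; [|apply Rplus_le_compat; apply Rmult_le_compat_l;
    [lra | apply (jacobi_mode_diag_le h l m a t k Ha)
    | lra | apply (jacobi_mode_diag_le h l m a t' k Ha)]].
  rewrite <- sum_f_R0_lin. apply sum_Rle. intros n _.
  set (u := jacobi_mode h l m n t). set (v := jacobi_mode h l m n t').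
  pose proof (bessel_coef_pos (2 * h + 1) (2 * n + l + m) a k Ha) as Hb.
  rewrite (Rabs_pos_eq _ Hb).
  assert (Huv : Rabs (2 * (u * v)) <= u * u + v * v).
  { apply Rabs_le. pose proof (Rle_0_sqr (u + v)). pose proof (Rle_0_sqr (u - v)).
    unfold Rsqr in *. lra. }
  nra.
Qed.

(** * Sums and products over the frontiers of the tree *)

Definition lsum (F : nat -> R) (l : list nat) : R := fold_right Rplus 0 (map F l).

Lemma lsum_app F l l' : lsum F (l ++ l') = lsum F l + lsum F l'.
Proof.
  unfold lsum. induction l as [|a l IH]; simpl; [ring|]. rewrite IH. ring.
Qed.

Lemma lsum_ext F G l : (forall i, In i l -> F i = G i) -> lsum F l = lsum G l.
Proof. intros H. unfold lsum. f_equal. apply map_ext_in, H. Qed.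

Lemma lsum_nonneg F l : (forall i, In i l -> 0 <= F i) -> 0 <= lsum F l.
Proof.
  unfold lsum. induction l as [|a l IH]; simpl; intros H; [lra|].
  specialize (IH (fun i Hi => H i (or_intror Hi))).
  specialize (H a (or_introl eq_refl)). lra.
Qed.

(** Expanding node [k] drops the head of the frontier and appends its two children. *)
Lemma seq_frontier k : (1 <= k)%nat ->
  seq k k = k :: seq (S k) (k - 1)
  /\ seq (S k) (S k) = seq (S k) (k - 1) ++ (2 * k :: 2 * k + 1 :: nil)%nat.
Proof.
  intros Hk. destruct k as [|k]; [lia|]. replace (S k - 1)%nat with k by lia.
  split; [reflexivity|].
  replace (S (S k)) with (k + 2)%nat at 2 by lia. rewrite seq_app. simpl seq at 2.
  do 2 f_equal; [|f_equal]; lia.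
Qed.

(* In heap order, expanding the nodes 1, ..., K leaves the frontier
   K + 1, ..., 2 K + 1. *)
Lemma frontier_telescope (F G : nat -> R) K :
  (forall k, (1 <= k <= K)%nat -> F k = F (2 * k)%nat + F (2 * k + 1)%nat + G k) ->
  lsum F (seq (S K) (S K)) + lsum G (seq 1 K) = F 1%nat.
Proof.
  induction K as [|K IH]; intros HFG; [unfold lsum; simpl; ring|].
  destruct (seq_frontier (S K) ltac:(lia)) as [E1 E2].
  rewrite E2, (seq_S K 1), !lsum_app. rewrite <- IH by (intros; apply HFG; lia).
  rewrite E1. change (lsum F (S K :: ?l)) with (F (S K) + lsum F l).
  rewrite HFG by lia. unfold lsum. simpl. ring.
Qed.

Definition ps_prod (l : list (nat -> R)) : nat -> R := fold_right PS_mult PS_const_1 l.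

Lemma ps_prod_app l l' : ps_prod (l ++ l') = PS_mult (ps_prod l) (ps_prod l').
Proof.
  induction l as [|a l IH]; simpl.
  - rewrite PS_mult_comm, PS_mult_1_r. reflexivity.
  - rewrite IH, PS_mult_assoc. reflexivity.
Qed.

Lemma exp_bounded_prod (r : nat -> R) (f : nat -> nat -> R) l :
  (forall i, In i l -> exp_bounded (r i) (f i)) ->
  exp_bounded (lsum r l) (ps_prod (map f l)).
Proof.
  induction l as [|a l IH]; intros H; simpl.
  - unfold lsum. simpl. rewrite <- exp_coef_0. apply exp_bounded_exp.
    rewrite Rabs_R0. apply Rle_refl.
  - apply exp_bounded_mult; [apply H; left; reflexivity|].
    apply IH. intros i Hi. apply H. right. exact Hi.
Qed.

Lemma ell_fuel_ext f d ms ns ns' : forall k, (1 <= k)%nat ->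
  (forall j, (k <= j)%nat -> ns j = ns' j) ->
  ell_fuel f d ms ns k = ell_fuel f d ms ns' k.
Proof.
  induction f as [|f IH]; intros k Hk H; [reflexivity|]. simpl.
  rewrite (IH (k + (k + 0))%nat) by (try lia; intros; apply H; lia).
  rewrite (IH (k + (k + 0) + 1)%nat) by (try lia; intros; apply H; lia).
  rewrite (H k) by lia. reflexivity.
Qed.

(** Descendants have larger indices. While [n_k] is summed, all other nodes of the frontier that
    starts at [k] therefore stay fixed. *)
Lemma ell_upd d ms ns k v i : (k < i)%nat -> ell d ms (upd ns k v) i = ell d ms ns i.
Proof.
  intros Hki. apply ell_fuel_ext; [lia|]. intros j Hj. unfold upd.
  destruct (Nat.eqb_spec j k); [lia | reflexivity].
Qed.

Lemma rho_nonneg d x k : Nat.Even d -> is_hopf d x -> (1 <= k <= d - 1)%nat -> 0 <= rho x k.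
Proof.
  intros [e ->] [Hr [Ha _]]. rewrite (Nat.mul_comm 2 e), Nat.div_mul in Ha by lia.
  revert k.
  enough (H : forall n k, (k < n)%nat -> (1 <= k <= 2 * e - 1)%nat -> 0 <= rho x k)
    by (intros k; apply (H (S k)); lia).
  induction n as [|n IH]; intros k Hkn Hk; [lia|].
  destruct (Nat.eq_dec k 1) as [->|Hk1]; [exact Hr|].
  pose proof PI_RGT_0.
  destruct (Nat.Even_or_Odd k) as [[j ->]|[j ->]].
  - rewrite rho_even by lia. specialize (Ha j ltac:(lia)).
    apply Rmult_le_pos; [apply IH; lia | apply cos_ge_0; lra].
  - rewrite rho_odd by lia. specialize (Ha j ltac:(lia)).
    apply Rmult_le_pos; [apply IH; lia | apply sin_ge_0; lra].
Qed.

(** * The sums over the inner nodes *)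

Section Tree.

Context (q d e p : nat) (x x' : hopf).
Context (Hq : (2 <= q)%nat) (Hd : d = (2 * e)%nat) (He : e = (2 ^ (q - 1))%nat).
Context (Hx : is_hopf d x) (Hx' : is_hopf d x').
Context (Hr : 0 < radius x) (Hr' : 0 < radius x') (Hrr' : radius x <> radius x').

Let rr (i : nat) : R := rho x i * rho x' i.
(** The point at which the transform is taken; [zeta x x'] is [A / rr 1]. *)
Let A : R := (radius x ^ 2 + radius x' ^ 2) / 2.

(* Half the number of coordinates below node [i], minus one. *)
Let off (i : nat) : nat := (2 ^ (q - 1 - Nat.log2 i) - 1)%nat.

Lemma half_eq : (d / 2)%nat = e.
Proof. rewrite Hd, Nat.mul_comm. apply Nat.div_mul. lia. Qed.

Lemma half_ge_2 : (2 <= e)%nat.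
Proof.
  rewrite He. replace (q - 1)%nat with (S (q - 2)) by lia. rewrite Nat.pow_succ_r'.
  pose proof (Nat.pow_nonzero 2 (q - 2) ltac:(lia)). lia.
Qed.

Lemma off_1 : off 1 = (e - 1)%nat.
Proof.
  unfold off. rewrite He. change (Nat.log2 1) with 0%nat.
  rewrite Nat.sub_0_r. reflexivity.
Qed.

Lemma off_leaf i : (e <= i <= 2 * e - 1)%nat -> off i = 0%nat.
Proof.
  intros Hi. pose proof half_ge_2. unfold off. replace (Nat.log2 i) with (q - 1)%nat.
  - rewrite Nat.sub_diag. reflexivity.
  - symmetry. apply Nat.log2_unique; [lia|].
    rewrite Nat.pow_succ_r', <- He. lia.
Qed.

(** The second clause is the offset [2 h + 1] of [bessel_coef_product]. The third identifies [alpha]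
    and [beta]; it contains [l] because they subtract 1 only after adding [ell]. *)
Lemma off_node k : (1 <= k <= e - 1)%nat ->
  off (2 * k + 1) = off (2 * k) /\ off k = (2 * off (2 * k) + 1)%nat
  /\ forall l, (l + 2 ^ (Nat.log2 (d / 4) - Nat.log2 k) - 1 = l + off (2 * k))%nat.
Proof.
  intros Hk. pose proof half_ge_2.
  assert (Hl : (Nat.log2 k < q - 1)%nat)
    by (apply Nat.log2_lt_pow2; [|rewrite <- He]; lia).
  unfold off. rewrite Nat.log2_succ_double, Nat.log2_double by lia.
  split; [reflexivity|].
  assert (Hd4 : Nat.log2 (d / 4) = (q - 2)%nat).
  { rewrite Hd, He. replace (q - 1)%nat with (S (q - 2)) by lia.
    rewrite Nat.pow_succ_r', Nat.mul_assoc, (Nat.mul_comm (2 * 2)), Nat.div_mul by lia.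
    apply Nat.log2_pow2. lia. }
  rewrite Hd4.
  replace (q - 2 - Nat.log2 k)%nat with (q - 1 - S (Nat.log2 k))%nat by lia.
  replace (q - 1 - Nat.log2 k)%nat with (S (q - 1 - S (Nat.log2 k))) by lia.
  rewrite Nat.pow_succ_r'.
  pose proof (Nat.pow_nonzero 2 (q - 1 - S (Nat.log2 k)) ltac:(lia)).
  split; [|intros l]; lia.
Qed.

Lemma Upsilon_mode ms ns k t : (1 <= k <= e - 1)%nat ->
  Upsilon d ms ns k t
  = jacobi_mode (off (2 * k)) (ell d ms ns (2 * k)) (ell d ms ns (2 * k + 1)) (ns k) t.
Proof.
  intros Hk. destruct (off_node k Hk) as [_ [_ Hoff]].
  unfold Upsilon, alpha, beta. rewrite !Hoff, jacobi_jval. reflexivity.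
Qed.

Let even_d : Nat.Even d.
Proof. exists e. exact Hd. Qed.

Lemma rr_nonneg i : (1 <= i <= 2 * e - 1)%nat -> 0 <= rr i.
Proof.
  intros Hi. apply Rmult_le_pos; apply (rho_nonneg d); auto; rewrite Hd; exact Hi.
Qed.

Lemma rr_even k : (1 <= k)%nat -> rr (2 * k) = rr k * (cos (angle x k) * cos (angle x' k)).
Proof. intros Hk. unfold rr. rewrite !rho_even by exact Hk. ring. Qed.

Lemma rr_odd k : (1 <= k)%nat ->
  rr (2 * k + 1) = rr k * (sin (angle x k) * sin (angle x' k)).
Proof. intros Hk. unfold rr. rewrite !rho_odd by exact Hk. ring. Qed.

Lemma rr_1 : rr 1 = radius x * radius x'.
Proof. reflexivity. Qed.

(** The children of [k] contribute [rr k * cos (angle x k - angle x' k)], so each expansion can only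
    decrease the sum. *)
Lemma rr_frontier_le k : (k <= e - 1)%nat ->
  lsum rr (seq (S k) (S k)) <= radius x * radius x'.
Proof.
  intros Hk. rewrite <- rr_1.
  rewrite <- (frontier_telescope rr
    (fun k => rr k * (1 - cos (angle x k - angle x' k))) k).
  - enough (0 <= lsum (fun k => rr k * (1 - cos (angle x k - angle x' k))) (seq 1 k)) by lra.
    apply lsum_nonneg. intros i Hi. apply in_seq in Hi.
    apply Rmult_le_pos; [apply rr_nonneg; lia|].
    pose proof (COS_bound (angle x i - angle x' i)). lra.
  - intros i Hi. rewrite rr_even, rr_odd, cos_minus by lia. ring.
Qed.

(** The gap is half the square of [radius x - radius x']; it makes every transform converge. *)
Lemma rr_lt_A : radius x * radius x' < A.
Proof.
  unfold A. pose proof (Rsqr_pos_lt (radius x - radius x') ltac:(lra)).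
  unfold Rsqr in *. lra.
Qed.

Definition node_coef (ms ns : nat -> nat) (i : nat) : nat -> R :=
  bessel_coef (off i) (ell d ms ns i) (rr i).

Definition nodes_coef (ms ns : nat -> nat) (l : list nat) : nat -> R :=
  ps_prod (map (node_coef ms ns) l).

Lemma exp_bounded_nodes ms ns l : (forall i, In i l -> 1 <= i <= 2 * e - 1)%nat ->
  exp_bounded (lsum rr l) (nodes_coef ms ns l).
Proof.
  intros Hl. apply exp_bounded_prod. intros i Hi.
  apply exp_bounded_bessel, rr_nonneg, Hl, Hi.
Qed.

(** [Psi] is a product of two modes with the orders of the children, so [jacobi_mode_product] splits
    the head of the frontier while the rest is carried along. *)
Lemma node_sum ms ns k : (1 <= k <= e - 1)%nat ->
  is_series (fun n => 2 * Psi d x x' ms (upd ns k n) k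
                      * laplace A p (nodes_coef ms (upd ns k n) (seq k k)))
            (laplace A p (nodes_coef ms ns (seq (S k) (S k)))).
Proof.
  intros Hk. destruct (off_node k Hk) as [Ho1 [Ho2 _]].
  destruct (seq_frontier k ltac:(lia)) as [E1 E2].
  set (l := ell d ms ns (2 * k)). set (m := ell d ms ns (2 * k + 1)).
  set (h := off (2 * k)).
  set (rest := nodes_coef ms ns (seq (S k) (k - 1))).
  set (u := fun n => jacobi_mode h l m n (angle x k) * jacobi_mode h l m n (angle x' k)).
  set (g := fun n => bessel_coef (2 * h + 1) (2 * n + l + m) (rr k)).
  set (f := PS_mult (bessel_coef h l (rr (2 * k))) (bessel_coef h m (rr (2 * k + 1)))).
  assert (Hrk : 0 <= rr k) by (apply rr_nonneg; lia).
  assert (HPsi : forall n, Psi d x x' ms (upd ns k n) k = u n).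
  { intros n. unfold Psi. rewrite !Upsilon_mode by exact Hk. unfold u, l, m, h.
    rewrite !ell_upd by lia. unfold upd. rewrite Nat.eqb_refl. reflexivity. }
  assert (Hg : forall n, nodes_coef ms (upd ns k n) (seq k k) = PS_mult (g n) rest).
  { intros n. rewrite E1. unfold nodes_coef. simpl. f_equal.
    - unfold node_coef, g. rewrite Ho2, ell_node by (rewrite half_eq; lia).
      unfold h, l, m. rewrite !ell_upd by lia.
      unfold upd. rewrite Nat.eqb_refl. reflexivity.
    - unfold rest, nodes_coef. f_equal. apply map_ext_in. intros i Hi.
      apply in_seq in Hi. unfold node_coef. rewrite ell_upd by lia. reflexivity. }
  replace (nodes_coef ms ns (seq (S k) (S k))) with (PS_mult f rest).
  2:{ rewrite E2. unfold nodes_coef. rewrite map_app, ps_prod_app.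
      rewrite PS_mult_comm. f_equal. cbn [map ps_prod fold_right]. rewrite PS_mult_1_r.
      unfold node_coef, f. rewrite Ho1. reflexivity. }
  apply (is_series_ext (fun n => 2 * u n * laplace A p (PS_mult (g n) rest))).
  { intros n. rewrite HPsi, Hg. reflexivity. }
  apply (laplace_sum A p (rr k) (lsum rr (seq (S k) (k - 1)))).
  - exact Hrk.
  - apply lsum_nonneg. intros i Hi. apply in_seq in Hi. apply rr_nonneg. lia.
  (* The two rates add up to that of the frontier before node [k] is expanded. *)
  - eapply Rle_lt_trans; [|apply rr_lt_A].
    eapply Rle_trans; [|apply (rr_frontier_le (k - 1)); lia].
    replace (S (k - 1)) with k by lia. rewrite E1. right. reflexivity.
  - intros n i Hi. apply bessel_coef_low. lia.
  - intros i. unfold f. rewrite rr_even, rr_odd by lia.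
    rewrite <- jacobi_mode_product. apply sum_eq. intros; unfold u, g; ring.
  - intros i. apply jacobi_mode_abs_le, Hrk.
  - apply exp_bounded_nodes. intros i Hi. apply in_seq in Hi. lia.
Qed.

Lemma INR_list_sum (f : nat -> nat) l :
  INR (list_sum (map f l)) = lsum (fun i => INR (f i)) l.
Proof.
  unfold lsum. induction l as [|a l IH]; simpl; [reflexivity|].
  rewrite plus_INR, IH. reflexivity.
Qed.

Lemma lsum_mirror (F : nat -> R) t : (t <= 2 * e)%nat ->
  lsum (fun i => F (2 * e - i)%nat) (seq (2 * e - t) t) = lsum F (seq 1 t).
Proof.
  induction t as [|t IH]; intros Ht; [reflexivity|].
  rewrite (seq_S t 1), lsum_app, <- IH by lia. cbn [seq].
  replace (S (2 * e - S t)) with (2 * e - t)%nat by lia.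
  unfold lsum. cbn [map fold_right].
  replace (2 * e - (2 * e - S t))%nat with (1 + t)%nat by lia. ring.
Qed.

Lemma ell_root ms ns : ell d ms ns 1 = (2 * sumN d ns + sumM d ms)%nat.
Proof.
  pose proof half_ge_2.
  apply INR_eq. rewrite plus_INR, mult_INR. unfold sumN, sumM.
  rewrite half_eq, !INR_list_sum. simpl (INR 2).
  rewrite <- (frontier_telescope (fun i => INR (ell d ms ns i))
    (fun i => 2 * INR (ns i)) (e - 1)).
  - replace (S (e - 1)) with e by lia.
    rewrite <- (lsum_mirror (fun i => INR (ms i)) e) by lia. replace (2 * e - e)%nat with e by lia.
    rewrite (lsum_ext _ (fun i => INR (ms (2 * e - i)%nat))).
    + rewrite Rplus_comm. f_equal. unfold lsum.
      induction (seq 1 (e - 1)) as [|a l IH]; simpl; [ring|]. rewrite IH. ring.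
    + intros i Hi. apply in_seq in Hi.
      rewrite ell_leaf by (rewrite ?half_eq; lia). rewrite Hd. reflexivity.
  - intros k Hk. rewrite (ell_node d ms ns k) by (rewrite half_eq; lia).
    rewrite !plus_INR, mult_INR. simpl (INR 2). ring.
Qed.

Let zeta_gt_1 : 1 < zeta x x'.
Proof.
  pose proof rr_lt_A as HA. unfold A in HA.
  assert (Hp : 0 < radius x * radius x') by (apply Rmult_lt_0_compat; assumption).
  unfold zeta. apply Rlt_div_r; lra.
Qed.

(** The part of a summand that does not depend on the quantum numbers. *)
Let K : C :=
  (cis (PI * (INR (p + (e - 1)) + 1 / 2))
   * RtoC (sqrt (PI / 2)
           * Rpower (zeta x x' ^ 2 - 1) (- ((INR (p + (e - 1)) + 1 / 2) / 2))
           / (radius x * radius x') ^ p))%C.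

(** For [N = L + e - 1] and [P = p + e - 1] the factorials of [summand] cancel those of
    [legendreQ_laplace]. As [m_1] is part of [L], the hypothesis gives [p < L]. *)
Lemma summand_laplace ms ns : (p < ms 1)%nat ->
  summand d p x x' ms ns = (RtoC (laplace A p (nodes_coef ms ns (seq 1 1))) * K)%C.
Proof.
  intros Hm. pose proof half_ge_2.
  assert (Hp : 0 < radius x * radius x') by (apply Rmult_lt_0_compat; assumption).
  unfold nodes_coef. cbn [seq map ps_prod fold_right].
  rewrite PS_mult_1_r. unfold node_coef. rewrite ell_root, off_1.
  unfold summand. set (L := (2 * sumN d ns + sumM d ms)%nat).
  assert (HL : (p < L)%nat).
  { unfold L, sumM. rewrite half_eq.
    replace e with (S (e - 1)) by lia. simpl. lia. }
  rewrite laplace_bessel by first [exact HL | split; [exact Hp | apply rr_lt_A]].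
  replace (A / rr 1) with (zeta x x') by (unfold A, zeta; rewrite rr_1; field; lra).
  rewrite rr_1.
  replace (INR L + (INR d - 3) / 2) with (INR (L + (e - 1)) - 1 / 2)
    by (rewrite Hd, plus_INR, minus_INR, mult_INR by lia; simpl; field).
  replace (INR p + (INR d - 1) / 2) with (INR (p + (e - 1)) + 1 / 2)
    by (rewrite Hd, plus_INR, minus_INR, mult_INR by lia; simpl; field).
  rewrite legendreQ_laplace by (exact zeta_gt_1 || lia).
  replace (L + (e - 1) - (p + (e - 1)) - 1)%nat with (L - p - 1)%nat by lia.
  replace (L + (e - 1) + (p + (e - 1)))%nat with (p + L + d - 2)%nat by lia.
  unfold K. rewrite Cmult_assoc, (Cmult_comm (RtoC _)), <- Cmult_assoc.
  rewrite (Cmult_assoc (RtoC (_ ^ p * _))), (Cmult_comm (RtoC (_ ^ p * _))).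
  rewrite <- (Cmult_assoc (cis _)). f_equal. rewrite <- !RtoC_mult. f_equal.
  field. repeat split; try apply INR_fact_neq_0. apply pow_nonzero. lra.
Qed.

(** Each node contributes a factor 2 in [node_sum] that [Psi] lacks, hence the [2 ^ k]. *)
Lemma is_n_sum_laplace k : (k <= e - 1)%nat -> forall ms ns, (p < ms 1)%nat ->
  is_n_sum d p x x' k ms ns
    (RtoC (laplace A p (nodes_coef ms ns (seq (S k) (S k))) / 2 ^ k) * K)%C.
Proof.
  induction k as [|k IH]; intros Hk ms ns Hm.
  - simpl is_n_sum. rewrite summand_laplace by exact Hm.
    do 2 f_equal. simpl. field.
  - cbn [is_n_sum].
    apply (is_weighted_sum_RtoC _ (fun n =>
      laplace A p (nodes_coef ms (upd ns (S k) n) (seq (S k) (S k))) / 2 ^ k)).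
    + intros n. apply IH; [lia | exact Hm].
    + pose proof (node_sum ms ns (S k) ltac:(lia)) as H.
      apply (is_series_scal_r (/ 2 ^ S k)) in H.
      assert (H2 : 2 ^ k <> 0) by (apply pow_nonzero; lra).
      eapply is_series_ext; [|exact H].
      intros n. cbv beta. rewrite <- tech_pow_Rmult. real_eq. field. exact H2.
Qed.

(** * The sums over the leaves *)

Let delta (i : nat) : R := phase x (d - i) - phase x' (d - i).

Lemma abs_phase_sum_le c : (c <= e - 1)%nat ->
  Rabs (lsum (fun i => rr i * cos (delta i)) (seq e c)) <= lsum rr (seq e c).
Proof.
  intros Hc. pose proof half_ge_2.
  assert (Hin : forall i, In i (seq e c) -> (1 <= i <= 2 * e - 1)%nat)
    by (intros i Hi; apply in_seq in Hi; lia).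
  unfold lsum. induction (seq e c) as [|a l IH]; simpl; [rewrite Rabs_R0; lra|].
  eapply Rle_trans; [apply Rabs_triang|]. apply Rplus_le_compat.
  - pose proof (rr_nonneg a (Hin a (or_introl eq_refl))).
    rewrite Rabs_mult, Rabs_pos_eq by assumption.
    rewrite <- (Rmult_1_r (rr a)) at 2. apply Rmult_le_compat_l; [assumption|].
    apply Rabs_le, COS_bound.
  - apply IH. intros i Hi. apply Hin. right. exact Hi.
Qed.

(** The innermost phase sum is over [m_(d/2)], which sits at leaf [e]; leaves thus become
    exponentials from left to right, and [m_j] with [j = e - c] sits at leaf [e + c]. *)
Lemma leaf_sum ms ns c : (c < e - 1)%nat ->
  let j := (e - c)%nat in
  is_series (fun n => neumann n * cos (INR n * (phase x j - phase x' j))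
     * laplace A p (PS_mult (nodes_coef (upd ms j n) ns (seq (e + c) (e - c)))
         (exp_coef (lsum (fun i => rr i * cos (delta i)) (seq e c)))))
   (laplace A p (PS_mult (nodes_coef ms ns (seq (e + S c) (e - S c)))
         (exp_coef (lsum (fun i => rr i * cos (delta i)) (seq e (S c)))))).
Proof.
  intros Hc j. pose proof half_ge_2.
  set (s := lsum (fun i => rr i * cos (delta i)) (seq e c)).
  set (i0 := (e + c)%nat).
  assert (Hj : (d - i0)%nat = j) by (unfold i0, j; lia).
  set (rest := PS_mult (nodes_coef ms ns (seq (e + S c) (e - S c))) (exp_coef s)).
  assert (Hri : 0 <= rr i0) by (apply rr_nonneg; unfold i0; lia).
  assert (Hell : forall ms i, (e <= i <= 2 * e - 1)%nat -> ell d ms ns i = ms (d - i)%nat)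
    by (intros; apply ell_leaf; rewrite ?half_eq; lia).
  pose proof (abs_phase_sum_le c ltac:(lia)) as Habs. fold s in Habs.
  assert (Hg : forall n,
    PS_mult (nodes_coef (upd ms j n) ns (seq (e + c) (e - c))) (exp_coef s)
    = PS_mult (bessel_coef 0 n (rr i0)) rest).
  { intros n. replace (e - c)%nat with (S (e - S c)) by lia.
    unfold nodes_coef, rest. cbn [seq map ps_prod fold_right].
    rewrite PS_mult_assoc. fold i0. f_equal.
    - unfold node_coef. rewrite off_leaf, Hell, Hj by (unfold i0; lia).
      unfold upd. rewrite Nat.eqb_refl. reflexivity.
    - f_equal. unfold nodes_coef. replace (S i0) with (e + S c)%nat by (unfold i0; lia).
      unfold ps_prod. f_equal. apply map_ext_in. intros i Hi. apply in_seq in Hi.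
      unfold node_coef. rewrite !Hell by lia. unfold upd.
      destruct (Nat.eqb_spec (d - i) j); [unfold j in *; lia | reflexivity]. }
  replace (PS_mult (nodes_coef ms ns (seq (e + S c) (e - S c))) _)
    with (PS_mult (exp_coef (rr i0 * cos (delta i0))) rest).
  2:{ unfold rest. rewrite <- PS_mult_assoc, (PS_mult_comm (exp_coef _)), PS_mult_assoc.
      rewrite exp_coef_plus. do 2 f_equal.
      rewrite seq_S, lsum_app. unfold s, lsum. simpl. unfold i0. ring. }
  apply (is_series_ext (fun n => neumann n * cos (INR n * delta i0)
     * laplace A p (PS_mult (bessel_coef 0 n (rr i0)) rest))).
  { intros n. rewrite Hg. unfold delta. rewrite Hj. reflexivity. }
  (* The exponentials are bounded with the rates of the leaves they replaced, so the total is still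
     that of all leaves. *)
  assert (Hsplit : lsum rr (seq e e)
    = rr i0 + (lsum rr (seq (e + S c) (e - S c)) + lsum rr (seq e c))).
  { replace e with (c + S (e - S c))%nat at 2 by lia.
    rewrite seq_app, lsum_app. unfold lsum, i0. simpl.
    replace (e + S c)%nat with (S (e + c)) by lia. ring. }
  apply (laplace_sum A p (rr i0) (lsum rr (seq (e + S c) (e - S c)) + lsum rr (seq e c))).
  - exact Hri.
  - apply Rplus_le_le_0_compat; apply lsum_nonneg; intros i Hi; apply in_seq in Hi;
      apply rr_nonneg; lia.
  - rewrite <- Hsplit. eapply Rle_lt_trans; [|apply rr_lt_A].
    pose proof (rr_frontier_le (e - 1) ltac:(lia)) as Hf.
    replace (S (e - 1)) with e in Hf by lia. exact Hf.
  - intros n i Hi. apply bessel_coef_low, Hi.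
  - intros i. apply bessel_coef_fourier.
  (* At angle 0 every term is nonnegative, and the expansion itself is the majorant. *)
  - intros i. pose proof (bessel_coef_fourier (rr i0) 0 i) as Hf.
    rewrite cos_0, Rmult_1_r in Hf. rewrite <- Hf. apply sum_Rle. intros n _.
    rewrite Rmult_0_r, cos_0, Rmult_1_r, Rabs_mult.
    rewrite (Rabs_pos_eq (bessel_coef _ _ _ _)) by (apply bessel_coef_pos, Hri).
    apply Rmult_le_compat_r; [apply bessel_coef_pos, Hri|].
    assert (Hn : 0 <= neumann n) by (unfold neumann; destruct (n =? 0)%nat; lra).
    rewrite (Rabs_pos_eq _ Hn). rewrite <- (Rmult_1_r (neumann n)) at 2.
    apply Rmult_le_compat_l; [exact Hn | apply Rabs_le, COS_bound].
  - apply exp_bounded_mult; [|apply exp_bounded_exp, Habs].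
    apply exp_bounded_nodes. intros i Hi. apply in_seq in Hi. lia.
Qed.

Lemma is_m_sum_laplace c : (c <= e - 1)%nat -> forall ms ns, (p < ms 1)%nat ->
  is_m_sum d p x x' c ms ns
    (RtoC (laplace A p (PS_mult (nodes_coef ms ns (seq (e + c) (e - c)))
         (exp_coef (lsum (fun i => rr i * cos (delta i)) (seq e c)))) / 2 ^ (e - 1))%R * K)%C.
Proof.
  pose proof half_ge_2.
  induction c as [|c IH]; intros Hc ms ns Hm.
  - cbn [is_m_sum]. rewrite half_eq. change (seq e 0) with (@nil nat).
    change (lsum _ nil) with 0. rewrite exp_coef_0, PS_mult_1_r.
    rewrite Nat.add_0_r, Nat.sub_0_r.
    pose proof (is_n_sum_laplace (e - 1) ltac:(lia) ms ns Hm) as Hn.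
    replace (S (e - 1)) with e in Hn by lia. exact Hn.
  - cbn [is_m_sum]. rewrite half_eq.
    replace (e + 1 - S c)%nat with (e - c)%nat by lia.
    apply (is_weighted_sum_RtoC _ (fun n =>
      laplace A p (PS_mult (nodes_coef (upd ms (e - c) n) ns (seq (e + c) (e - c)))
         (exp_coef (lsum (fun i => rr i * cos (delta i)) (seq e c)))) / 2 ^ (e - 1))).
    + intros n. apply IH; [lia|]. unfold upd.
      destruct (Nat.eqb_spec 1 (e - c)); [lia | exact Hm].
    + pose proof (leaf_sum ms ns c ltac:(lia)) as H1.
      apply (is_series_scal_r (/ 2 ^ (e - 1))) in H1.
      eapply is_series_ext; [|exact H1].
      intros n. real_eq. unfold Rdiv. ring.
Qed.

(** * From the transform to [chi] *)

Lemma cart_dist_sum t : (t <= e)%nat ->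
  sum_n_m (fun j => (cart d x j - cart d x' j) ^ 2) 1 (2 * t)
  = lsum (fun i => rho x i ^ 2 + rho x' i ^ 2 - 2 * (rr i * cos (delta i))) (seq e t).
Proof.
  induction t as [|t IH]; intros Ht.
  - rewrite sum_n_m_zero by lia. reflexivity.
  - replace (2 * S t)%nat with (S (S (2 * t))) by lia.
    rewrite !sum_n_Sm, IH, seq_S, lsum_app by lia.
    change plus with Rplus. rewrite Rplus_assoc. f_equal.
    unfold lsum. cbn [map fold_right]. rewrite Rplus_0_r.
    replace (S (2 * t)) with (2 * (e + t) + 1 - d)%nat by lia.
    replace (S (2 * (e + t) + 1 - d)) with (2 * (e + t) + 2 - d)%nat by lia.
    rewrite !cart_cos, !cart_sin by (rewrite ?half_eq; (exact even_d || lia)).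
    unfold rr, delta. rewrite cos_minus.
    set (u := phase x _). set (v := phase x' _).
    pose proof (sin2_cos2 u) as Eu. pose proof (sin2_cos2 v) as Ev.
    unfold Rsqr in Eu, Ev.
    set (a := rho x (e + t)). set (b := rho x' (e + t)).
    transitivity (a ^ 2 * (sin u * sin u + cos u * cos u)
      + b ^ 2 * (sin v * sin v + cos v * cos v)
      - 2 * (a * b * (cos u * cos v + sin u * sin v))); [ring|].
    rewrite Eu, Ev. ring.
Qed.

Lemma rho_sqr_sum y : lsum (fun i => rho y i ^ 2) (seq e e) = radius y ^ 2.
Proof.
  pose proof half_ge_2.
  pose proof (frontier_telescope (fun i => rho y i ^ 2) (fun _ => 0) (e - 1)) as H1.
  replace (S (e - 1)) with e in H1 by lia.
  change (radius y ^ 2) with (rho y 1 ^ 2). rewrite <- H1.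
  - replace (lsum (fun _ => 0) (seq 1 (e - 1))) with 0; [ring|].
    clear. unfold lsum. induction (seq 1 (e - 1)) as [|a l IH]; simpl; lra.
  - intros k Hk. rewrite rho_even, rho_odd by lia.
    pose proof (sin2_cos2 (angle y k)) as E. unfold Rsqr in E.
    transitivity (rho y k ^ 2 * (sin (angle y k) * sin (angle y k)
      + cos (angle y k) * cos (angle y k))); [rewrite E; ring | ring].
Qed.

Let s : R := lsum (fun i => rr i * cos (delta i)) (seq e (e - 1)).

(** The law of cosines in each coordinate plane but the last, together with [bigR], collects all the
    squared leaf radii into [2 A]. The last leaf has no cosine term. *)
Lemma chi_eq : 0 < bigR d x -> 0 < bigR d x' ->
  chi d x x' = (A - s) / (bigR d x * bigR d x').
Proof.
  intros HR HR'. pose proof half_ge_2.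
  unfold chi. replace (d - 2)%nat with (2 * (e - 1))%nat by lia.
  rewrite cart_dist_sum by lia.
  assert (E : forall y, radius y ^ 2
    = lsum (fun i => rho y i ^ 2) (seq e (e - 1)) + bigR d y ^ 2).
  { intros y. rewrite <- rho_sqr_sum.
    replace (seq e e) with (seq e (e - 1) ++ (d - 1)%nat :: nil).
    - rewrite lsum_app. unfold lsum. simpl. unfold bigR. ring.
    - replace (d - 1)%nat with (e + (e - 1))%nat by lia. rewrite <- seq_S.
      f_equal. lia. }
  unfold A. rewrite !E. unfold s.
  replace (lsum (fun i => _ + _ - _) (seq e (e - 1)))
    with (lsum (fun i => rho x i ^ 2) (seq e (e - 1))
          + lsum (fun i => rho x' i ^ 2) (seq e (e - 1))
          - 2 * lsum (fun i => rr i * cos (delta i)) (seq e (e - 1))).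
  - field. lra.
  - clear. unfold lsum.
    induction (seq e (e - 1)) as [|a l IH]; cbn [map fold_right]; [ring|].
    rewrite <- IH. ring.
Qed.

(** Only leaf [d - 1] is left, with order [m] and offset 0, times [exp (s z)]; [laplace_shift] moves
    [A] to [A - s], the numerator in [chi_eq]. *)
Lemma is_multi_sum_laplace m : (p < m)%nat -> 0 < bigR d x -> 0 < bigR d x' ->
  1 < chi d x x' /\
  is_multi_sum d p m x x'
    (RtoC ((bigR d x * bigR d x') ^ p * bessel_laplace m p (chi d x x')
           / 2 ^ (e - 1)) * K)%C.
Proof.
  intros Hm HR HR'. pose proof half_ge_2.
  set (a := bigR d x * bigR d x'). assert (Ha : 0 < a) by (apply Rmult_lt_0_compat; assumption).
  assert (Hlt : a + Rabs s < A).
  { eapply Rle_lt_trans; [|apply rr_lt_A].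
    pose proof (rr_frontier_le (e - 1) ltac:(lia)) as Hf.
    replace (S (e - 1)) with e in Hf by lia.
    replace (seq e e) with (seq e (e - 1) ++ (d - 1)%nat :: nil) in Hf.
    2:{ replace (d - 1)%nat with (e + (e - 1))%nat by lia. rewrite <- seq_S.
        f_equal. lia. }
    rewrite lsum_app in Hf. pose proof (abs_phase_sum_le (e - 1) ltac:(lia)) as Hs.
    unfold lsum at 2 in Hf. cbn [map fold_right] in Hf.
    change (rr (d - 1)) with a in Hf. fold s in Hs. lra. }
  pose proof (Rle_abs s) as Hs.
  assert (Hchi : 1 < chi d x x').
  { rewrite chi_eq by assumption. fold a. apply Rlt_div_r; lra. }
  split; [exact Hchi|].
  unfold is_multi_sum. rewrite half_eq.
  pose proof (is_m_sum_laplace (e - 1) (le_n _) (upd (fun _ => O) 1 m) (fun _ => O) Hm) as H1.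
  fold s in H1. replace (e - (e - 1))%nat with 1%nat in H1 by lia.
  replace (e + (e - 1))%nat with (d - 1)%nat in H1 by lia.
  unfold nodes_coef in H1. cbn [seq map ps_prod fold_right] in H1.
  rewrite PS_mult_1_r in H1. unfold node_coef in H1.
  rewrite off_leaf, ell_leaf in H1 by (rewrite ?half_eq; lia).
  replace (d - (d - 1))%nat with 1%nat in H1 by lia.
  change (upd (fun _ => O) 1 m 1) with m in H1. change (rr (d - 1)) with a in H1.
  rewrite (laplace_shift A p a) in H1.
  - rewrite laplace_bessel in H1 by (lia || lra).
    rewrite !Nat.add_0_r in H1. rewrite chi_eq by assumption. exact H1.
  - lra.
  - exact Hlt.
  - apply exp_bounded_bessel. lra.
  - intros k Hk. apply bessel_coef_low. lia.
Qed.

End Tree.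

(** * Matching the prefactors *)

Lemma cis_shift t k : cis (t + INR k * PI) = (RtoC ((-1) ^ k) * cis t)%C.
Proof.
  induction k as [|k IH].
  - simpl. rewrite Rmult_0_l, Rplus_0_r. ring.
  - rewrite S_INR. replace (t + (INR k + 1) * PI) with (t + INR k * PI + PI) by ring.
    transitivity (- cis (t + INR k * PI))%C.
    + unfold cis. rewrite neg_cos, neg_sin. reflexivity.
    + rewrite IH. simpl pow. rewrite RtoC_mult. ring.
Qed.

Theorem theorem7p11 (q d p m : nat) (x x' : hopf)
  (hq : (2 <= q)%nat) (hd : d = (2 ^ q)%nat) (hm : (p + 1 <= m)%nat)
  (hx : is_hopf d x) (hx' : is_hopf d x')
  (hr : 0 < radius x) (hr' : 0 < radius x')
  (hR : 0 < bigR d x) (hR' : 0 < bigR d x')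
  (hrr' : radius x <> radius x') :
  exists S : C,
    is_multi_sum d p m x x' S /\
    legendreQ (INR m - 1 / 2) (INR p + 1 / 2) (chi d x x') =
    (RtoC ((-1) ^ (d / 2 - 1) * 2 ^ (d / 2 - 1)
           * (INR (fact (p + m)) / INR (fact (m - p - 1)))
           * Rpower (chi d x x' ^ 2 - 1) (- (INR p / 2) - 1 / 4)
           * (radius x * radius x' / (bigR d x * bigR d x')) ^ p
           * Rpower ((Rmax (radius x) (radius x') ^ 2
                      - Rmin (radius x) (radius x') ^ 2)
                     / (2 * radius x * radius x'))
                    (INR p + (INR d - 1) / 2))
     * S)%C.
Proof.
  set (e := (2 ^ (q - 1))%nat).
  assert (Hd : d = (2 * e)%nat).
  { rewrite hd. unfold e. replace q with (S (q - 1)) at 1 by lia. apply Nat.pow_succ_r'. }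
  pose proof (half_ge_2 q d e hq Hd eq_refl) as He.
  destruct (is_multi_sum_laplace q d e p x x' hq Hd eq_refl hx hx' hr hr' hrr' m
    ltac:(lia) hR hR') as [Hchi Hsum].
  eexists. split; [exact Hsum|].
  rewrite legendreQ_laplace, (half_eq q d e hq Hd eq_refl) by (exact Hchi || lia).
  set (P := (p + (e - 1))%nat).
  (* The Legendre functions on the two sides have upper indices differing by [e - 1], which is the
     origin of the sign [(-1) ^ (d / 2 - 1)]. *)
  replace (PI * (INR P + 1 / 2)) with (PI * (INR p + 1 / 2) + INR (e - 1) * PI)
    by (unfold P; rewrite plus_INR; ring).
  rewrite cis_shift.
  set (D := (Rmax (radius x) (radius x') ^ 2 - Rmin (radius x) (radius x') ^ 2)
            / (2 * radius x * radius x')).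
  assert (Hrr : 0 < radius x * radius x') by (apply Rmult_lt_0_compat; assumption).
  assert (HD : 0 < D).
  { unfold D. apply Rdiv_lt_0_compat; [|lra].
    unfold Rmax, Rmin. destruct (Rle_dec (radius x) (radius x')); nra. }
  (* Hence the power of [D] in the statement cancels the power of [zeta^2 - 1] in the summands. *)
  assert (HD2 : zeta x x' ^ 2 - 1 = D ^ 2).
  { unfold zeta, D, Rmax, Rmin.
    destruct (Rle_dec (radius x) (radius x')); field; lra. }
  replace (INR p + (INR d - 1) / 2) with (INR P + 1 / 2)
    by (unfold P; rewrite Hd, plus_INR, minus_INR, mult_INR by lia; simpl; field).
  assert (HDD : Rpower (D ^ 2) (- ((INR P + 1 / 2) / 2)) = / Rpower D (INR P + 1 / 2)).
  { rewrite <- Rpower_pow, Rpower_mult, <- Rpower_Ropp by exact HD.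
    f_equal. simpl. field. }
  rewrite HD2, HDD.
  replace (- (INR p / 2) - 1 / 4) with (- ((INR p + 1 / 2) / 2)) by field.
  pose proof (exp_pos ((INR P + 1 / 2) * ln D)) as Hpos.
  change (0 < Rpower D (INR P + 1 / 2)) in Hpos.
  pose proof (pow_1_even (e - 1)) as Hs.
  replace (2 * (e - 1))%nat with ((e - 1) + (e - 1))%nat in Hs by lia.
  rewrite pow_add in Hs.
  rewrite (Nat.add_comm p m).
  rewrite Cmult_comm.
  set (c := cis (PI * (INR p + 1 / 2))).
  match goal with |- (RtoC ?u * c = RtoC ?a * (RtoC ?b * (RtoC ?s1 * c * RtoC ?k)))%C =>
    transitivity (RtoC (a * b * s1 * k) * c)%C; [do 2 f_equal | rewrite !RtoC_mult; ring]
  end.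
  set (g := (-1) ^ (e - 1)) in *.
  set (B := bessel_laplace _ _ _). set (Rc := Rpower (chi d x x' ^ 2 - 1) _).
  set (RD := Rpower D _) in *.
  replace ((radius x * radius x' / (bigR d x * bigR d x')) ^ p)
    with ((radius x * radius x') ^ p / (bigR d x * bigR d x') ^ p)
    by (unfold Rdiv; rewrite (Rpow_mult_distr (radius x * radius x')), pow_inv;
        reflexivity).
  assert (HRR : 0 < bigR d x * bigR d x') by (apply Rmult_lt_0_compat; assumption).
  set (N1 := INR (fact (m + p))). set (N2 := INR (fact (m - p - 1))).
  (* The sign occurs twice, in the prefactor and from [cis_shift]. *)
  transitivity (g * g * (sqrt (PI / 2) * (N1 / N2) * Rc * B)); [rewrite Hs; ring|].
  field. repeat split; try apply INR_fact_neq_0; try (apply pow_nonzero; lra); lra.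
Qed.
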